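(* Let $\mathbf p$ be a polynomial $\ell$-weight of coweight $\zeta$ and let $V$ be a root graded $Y_\mu(\mathfrak g)$-module. Then the composition $D^V_{\mathbf p,w}\circ S_{\mathbf p}(w)$ induces a linear automorphism of the space $V^w$, denoted $T^V_{\mathbf p}(w)$, which is an isomorphism of $Y_{\mu+\zeta}(\mathfrak g)$-modules $$T^V_{\mathbf p}(w):\ L(\mathbf p)_w\,\tilde\otimes\,V\longrightarrow V\,\tilde\otimes\,L(\mathbf p)_w.$$
   Context: Ground field $\mathbb C$, $\mathbb N=\mathbb Z_{\ge0}$. $\mathfrak g$ is a finite-dimensional simple Lie algebra with Cartan subalgebra $\mathfrak h$, Dynkin nodes $I=\{1,\dots,r\}$, simple roots $\alpha_i\in\mathfrak h^*$, invariant symmetric form $(\,,)$ on $\mathfrak h^*$ normalized so that the $d_i=(\alpha_i,\alpha_i)/2$ are coprime positive integers; $c_{ij}=2(\alpha_i,\alpha_j)/(\alpha_i,\alpha_i)$, $d_{ij}=(\alpha_i,\alpha_j)/2$; $\mathbf Q=\bigoplus_i\mathbb Z\alpha_i$. The fundamental coweights $\varpi_i^\vee\in\mathfrak h$ are dual to the $\alpha_i$ for the pairing $\langle\,,\rangle$; coweights are elements of $\bigoplus_i\mathbb Z\varpi_i^\vee$. Shifted Yangian: for a coweight $\mu$, $Y_\mu(\mathfrak g)$ is the associative algebra with generators $x_{i,n}^\pm,\xi_{i,p}$ ($i\in I$, $n\in\mathbb N$, $p\in\mathbb Z$) and relations $[\xi_{i,p},\xi_{j,q}]=0$; $[x^+_{i,m},x^-_{j,n}]=\delta_{ij}\xi_{i,m+n}$;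 $[\xi_{i,p+1},x^\pm_{j,n}]-[\xi_{i,p},x^\pm_{j,n+1}]=\pm d_{ij}(\xi_{i,p}x^\pm_{j,n}+x^\pm_{j,n}\xi_{i,p})$; $[x^\pm_{i,m+1},x^\pm_{j,n}]-[x^\pm_{i,m},x^\pm_{j,n+1}]=\pm d_{ij}(x^\pm_{i,m}x^\pm_{j,n}+x^\pm_{j,n}x^\pm_{i,m})$; $(\mathrm{ad}_{x^\pm_{i,0}})^{1-c_{ij}}(x^\pm_{j,0})=0$ for $i\ne j$; $\xi_{i,-\langle\mu,\alpha_i\rangle-1}=1$ and $\xi_{i,p}=0$ for $p<-\langle\mu,\alpha_i\rangle-1$. It is $\mathbf Q$-graded with $x_{i,n}^\pm$ of weight $\pm\alpha_i$ and $\xi_{i,p}$ of weight $0$. $Y^0_\mu(\mathfrak g)$ is the subalgebra generated by the $\xi_{i,p}$. Put $x_i^\pm(z)=\sum_{n\ge0}x_{i,n}^\pm z^{-n-1}$, $\xi_i(z)=\sum_p\xi_{i,p}z^{-p-1}$, $\overline\xi_i(z)=z^{-\langle\mu,\alpha_i\rangle}\xi_i(z)$. S-series: the GKLO series $A_i(z)\in1+z^{-1}Y^0_\mu(\mathfrak g)[[z^{-1}]]$ are determined by $\overline\xi_i(z)=\frac1{A_i(z)A_i(z-d_i)}\prod_{j:c_{ji}<0}\prod_{t=1}^{-c_{ji}}A_j(z-d_{ij}-td_j)$ for $i\in I$; write $A_i(z)=\exp(\sum_{m\ge0}d_ia_{i,m}z^{-m-1})$. For $G(z)\in1+z^{-1}\mathbb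 C[[z^{-1}]]$ and $x$ in an algebra, $G(z)^x=\exp(x\log G(z))$. $S_i(z)\in1+z^{-1}Y^0_\mu(\mathfrak g)[[z^{-1}]]$ is the unique solution of $S_i(z+d_i)=S_i(z)A_i(z)\left(\frac z{z+d_i}\right)^{a_{i,0}}$. A polynomial $\ell$-weight of (dominant) coweight $\zeta$ is a tuple $\mathbf p=(\mathbf p_i(z))_{i\in I}$ of monic polynomials with $\deg\mathbf p_i=\langle\zeta,\alpha_i\rangle$. If $\mathbf p_i(z)=\prod_{k}(z-a_{i,k})$, set $S_{\mathbf p}(w)=\prod_{i\in I}\prod_kS_i(w+a_{i,k})\in 1+w^{-1}Y^0_\mu(\mathfrak g)[[w^{-1}]]$. $L(\mathbf p)_w$ is the $Y_\zeta(\mathfrak g)$-module $\mathbb C[w]$ on which $x_i^\pm(z)$ act as $0$ and $\xi_i(z)$ acts as $\mathbf p_i(z-w)$. Root grading: a $Y_\mu(\mathfrak g)$-module $V$ is root graded if it is equipped with a decomposition $V=\bigoplus_{\beta\in\mathbf Q}V_{(\beta)}$ making it a $\mathbf Q$-graded module over the $\mathbf Q$-graded algebra $Y_\mu(\mathfrak g)$. Then $V^w\subset V((w^{-1}))$ is the linear span of the subspaces $V_{(\beta)}((w^{-1}))$, $\beta\in\mathbf Q$; it is acted on by $Y_\mu(\mathfrak g)[w]$ and $Y_\mu(\mathfrak g)[[w^{-1}]]$. $D^V_{\mathbf p,w}$ is the automorphism of $V^w$ given by $g(w)\mapsto g(w)\prod_{i\in I}\mathbf p_i(-w)^{-\langle\varpi_i^\vee,\beta\rangle}$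 for $g(w)\in V_{(\beta)}((w^{-1}))$ (powers expanded in $\mathbb C((w^{-1}))$). Completed tensor products: for $f(z)=\sum_{n\in\mathbb Z}f_nz^{-n-1}$ set $\langle f(z)\rangle_+=\sum_{n\ge0}f_nz^{-n-1}$ (principal part in $z$). There are algebra homomorphisms $F,G:Y_{\mu+\zeta}(\mathfrak g)\to Y_\mu(\mathfrak g)[w]$, $F:\ x_i^+(z)\mapsto\langle\mathbf p_i(z-w)x_i^+(z)\rangle_+,\ x_i^-(z)\mapsto x_i^-(z),\ \xi_i(z)\mapsto\mathbf p_i(z-w)\xi_i(z)$; $G:\ x_i^+(z)\mapsto x_i^+(z),\ x_i^-(z)\mapsto\langle\mathbf p_i(z-w)x_i^-(z)\rangle_+,\ \xi_i(z)\mapsto\mathbf p_i(z-w)\xi_i(z)$ (these describe the tensor products $L(\mathbf p)_w\otimes V$ and $V\otimes L(\mathbf p)_w$, with underlying space $V[w]$, given by the shifted coproduct). $L(\mathbf p)_w\tilde\otimes V$ and $V\tilde\otimes L(\mathbf p)_w$ denote the $Y_{\mu+\zeta}(\mathfrak g)$-modules on the space $V^w$ obtained by pullback of its $Y_\mu(\mathfrak g)[w]$-module structure along $F$ and $G$ respectively. *)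

(* Defs.v *)
From HB Require Import structures.
From mathcomp Require Import all_boot all_order all_algebra.
From mathcomp Require Import generic_quotient all_classical reals.
From mathcomp Require Export complex.

Set Implicit Arguments.
Unset Strict Implicit.
Unset Printing Implicit Defensive.

Import Order.TTheory GRing.Theory Num.Theory.
Local Open Scope quotient_scope.
Local Open Scope classical_set_scope.
Local Open Scope ring_scope.

(* The library's [algType] requires 1 != 0, which for the algebras below would
   need a PBW-type theorem.  Here a K-algebra is a ring, possibly with 1 = 0,
   together with a ring morphism [algc] from K to its centre. *)
HB.mixin Record isPzAlg (K : pzRingType) A of GRing.PzRing A := {
  algc : K -> A;
  algc_zmod_morphism : zmod_morphism algc;
  algc_monoid_morphism : monoid_morphism algc;
  algcC : forall k x, algc k * x = x * algc k
}.
#[short(type="pzAlgType")]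
HB.structure Definition PzAlg (K : pzRingType) := {A of isPzAlg K A & GRing.PzRing A}.

HB.instance Definition _ (K : pzRingType) (A : pzAlgType K) :=
  GRing.isZmodMorphism.Build K A algc algc_zmod_morphism.
HB.instance Definition _ (K : pzRingType) (A : pzAlgType K) :=
  GRing.isMonoidMorphism.Build K A algc algc_monoid_morphism.

Section RegularPzAlg.
Variable K : comNzRingType.
Let reg (k : K) : K^o := k.
Let reg_zmod : zmod_morphism reg. Proof. by []. Qed.
Let reg_monoid : monoid_morphism reg. Proof. by []. Qed.
Let regC (k : K) (x : K^o) : reg k * x = x * reg k. Proof. exact: mulrC. Qed.
HB.instance Definition _ := isPzAlg.Build K K^o reg_zmod reg_monoid regC.
End RegularPzAlg.

Definition Cx (R : realType) : numClosedFieldType := Num.ClosedField.clone R[i] _.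

Inductive term (K X : Type) :=
| tgen of X
| tscal of K
| tadd of term K X & term K X
| tmul of term K X & term K X.

Arguments tgen {K X} _.
Arguments tscal {K X} _.

Section TermOps.
Variables (K : pzRingType) (X : Type).
Implicit Types a b : term K X.
Definition tscale (k : K) a := tmul (tscal k) a.
Definition tsub a b := tadd a (tscale (-1) b).
Definition tcomm a b := tsub (tmul a b) (tmul b a).
Definition tanti a b := tadd (tmul a b) (tmul b a).
End TermOps.

Section Presentation.
Variables (K : comNzRingType) (X : Type) (rel : term K X -> term K X -> Prop).

HB.instance Definition _ := gen_eqMixin (term K X).
HB.instance Definition _ := gen_choiceMixin (term K X).

Inductive tcong : term K X -> term K X -> Prop :=
| tcong_rel a b : rel a b -> tcong a b
| tcong_refl a : tcong a a
| tcong_sym a b : tcong a b -> tcong b a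
| tcong_trans a b c : tcong a b -> tcong b c -> tcong a c
| tcong_add a a' b b' : tcong a a' -> tcong b b' -> tcong (tadd a b) (tadd a' b')
| tcong_mul a a' b b' : tcong a a' -> tcong b b' -> tcong (tmul a b) (tmul a' b')
| tcong_addA a b c : tcong (tadd a (tadd b c)) (tadd (tadd a b) c)
| tcong_addC a b : tcong (tadd a b) (tadd b a)
| tcong_add0 a : tcong (tadd (tscal 0) a) a
| tcong_mulA a b c : tcong (tmul a (tmul b c)) (tmul (tmul a b) c)
| tcong_mul1 a : tcong (tmul (tscal 1) a) a
| tcong_mul0 a : tcong (tmul (tscal 0) a) (tscal 0)
| tcong_mulDl a b c : tcong (tmul (tadd a b) c) (tadd (tmul a c) (tmul b c))
| tcong_mulDr a b c : tcong (tmul a (tadd b c)) (tadd (tmul a b) (tmul a c))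
| tcong_scalD k l : tcong (tscal (k + l)) (tadd (tscal k) (tscal l))
| tcong_scalM k l : tcong (tscal (k * l)) (tmul (tscal k) (tscal l))
| tcong_scalC k a : tcong (tmul (tscal k) a) (tmul a (tscal k)).

Definition tcongb (a b : term K X) : bool := `[< tcong a b >].

Lemma tcongb_refl : reflexive tcongb.
Proof. by move=> a; apply/asboolP; exact: tcong_refl. Qed.
Lemma tcongb_sym : symmetric tcongb.
Proof. by move=> a b; apply/asboolP/asboolP => /tcong_sym. Qed.
Lemma tcongb_trans : transitive tcongb.
Proof.
by move=> b a c /asboolP ab /asboolP bc; apply/asboolP; exact: tcong_trans bc.
Qed.

Canonical tcong_equiv := EquivRel tcongb tcongb_refl tcongb_sym tcongb_trans.

Definition palg : Type := {eq_quot tcong_equiv}.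
HB.instance Definition _ := Choice.on palg.

Definition pclass (a : term K X) : palg := (\pi_{eq_quot tcong_equiv} a)%qT.
Definition prepr (x : palg) : term K X :=
  repr (x : {eq_quot tcong_equiv}).

Lemma preprK : cancel prepr pclass.
Proof. by move=> x; rewrite /pclass /prepr reprK. Qed.

Lemma pclassP a b : pclass a = pclass b <-> tcong a b.
Proof.
split=> [/eqP|ab]; last by apply/eqP; rewrite eqmodE; apply/asboolP.
by rewrite eqmodE => /asboolP.
Qed.

Lemma pclassK a : tcong (prepr (pclass a)) a.
Proof. by apply/pclassP; rewrite preprK. Qed.

Let padd x y := pclass (tadd (prepr x) (prepr y)).
Let pmul x y := pclass (tmul (prepr x) (prepr y)).
Let popp x := pclass (tscale (-1) (prepr x)).
Let paddE a b : padd (pclass a) (pclass b) = pclass (tadd a b).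
Proof. by apply/pclassP; apply: tcong_add; exact: pclassK. Qed.
Let pmulE a b : pmul (pclass a) (pclass b) = pclass (tmul a b).
Proof. by apply/pclassP; apply: tcong_mul; exact: pclassK. Qed.
Let poppE a : popp (pclass a) = pclass (tscale (-1) a).
Proof. by apply/pclassP; apply: tcong_mul; [exact: tcong_refl|exact: pclassK]. Qed.
Let paddA : associative padd.
Proof.
move=> x y z; rewrite -[x]preprK -[y]preprK -[z]preprK !paddE.
by apply/pclassP; exact: tcong_addA.
Qed.
Let paddC : commutative padd.
Proof.
by move=> x y; rewrite -[x]preprK -[y]preprK !paddE; apply/pclassP; exact: tcong_addC.
Qed.
Let padd0 : left_id (pclass (tscal 0)) padd.
Proof. by move=> x; rewrite -[x]preprK paddE; apply/pclassP; exact: tcong_add0. Qed.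
Let paddN : left_inverse (pclass (tscal 0)) popp padd.
Proof.
move=> x; rewrite -[x]preprK poppE paddE; apply/pclassP.
apply: tcong_trans (tcong_mul0 (prepr x)).
apply: (@tcong_trans _ (tmul (tadd (tscal (-1)) (tscal 1)) (prepr x))).
  apply: tcong_sym; apply: tcong_trans (tcong_mulDl _ _ _) _.
  by apply: tcong_add; [exact: tcong_refl|exact: tcong_mul1].
apply: tcong_mul; last exact: tcong_refl.
by apply: tcong_trans (tcong_sym (tcong_scalD _ _)) _; rewrite addNr; exact: tcong_refl.
Qed.

HB.instance Definition _ := GRing.isZmodule.Build palg paddA paddC padd0 paddN.

Let pmulA : associative pmul.
Proof.
move=> x y z; rewrite -[x]preprK -[y]preprK -[z]preprK !pmulE.
by apply/pclassP; exact: tcong_mulA.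
Qed.
Let pmul1l : left_id (pclass (tscal 1)) pmul.
Proof. by move=> x; rewrite -[x]preprK pmulE; apply/pclassP; exact: tcong_mul1. Qed.
Let pmul1r : right_id (pclass (tscal 1)) pmul.
Proof.
move=> x; rewrite -[x]preprK pmulE; apply/pclassP.
exact: tcong_trans (tcong_sym (tcong_scalC _ _)) (tcong_mul1 _).
Qed.
Let pmulDl : left_distributive pmul +%R.
Proof.
move=> x y z; rewrite -[x]preprK -[y]preprK -[z]preprK.
rewrite [pclass _ + pclass _]paddE !pmulE [RHS]paddE.
by apply/pclassP; exact: tcong_mulDl.
Qed.
Let pmulDr : right_distributive pmul +%R.
Proof.
move=> x y z; rewrite -[x]preprK -[y]preprK -[z]preprK.
rewrite [pclass _ + pclass _]paddE !pmulE [RHS]paddE.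
by apply/pclassP; exact: tcong_mulDr.
Qed.

HB.instance Definition _ :=
  GRing.Zmodule_isPzRing.Build palg pmulA pmul1l pmul1r pmulDl pmulDr.

Let pc (k : K) : palg := pclass (tscal k).
Let pcB : zmod_morphism pc.
Proof.
move=> k l; rewrite [- pc l]poppE [RHS]paddE; apply/pclassP.
apply: tcong_trans (tcong_scalD _ _) _; apply: tcong_add; first exact: tcong_refl.
by rewrite -[- l]mulN1r; exact: tcong_scalM.
Qed.
Let pcM : monoid_morphism pc.
Proof. by split=> // k l; rewrite [RHS]pmulE; apply/pclassP; exact: tcong_scalM. Qed.
Let pcC (k : K) (x : palg) : pc k * x = x * pc k.
Proof.
rewrite -[x]preprK [LHS]pmulE [RHS]pmulE; apply/pclassP; exact: tcong_scalC.
Qed.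

HB.instance Definition _ := isPzAlg.Build K palg pcB pcM pcC.

Definition pgen (x : X) : palg := pclass (tgen x).

Lemma pclass_add a b : pclass (tadd a b) = pclass a + pclass b.
Proof. by rewrite [RHS]paddE. Qed.
Lemma pclass_mul a b : pclass (tmul a b) = pclass a * pclass b.
Proof. by rewrite [RHS]pmulE. Qed.
Lemma pclass_scal k : pclass (tscal k) = algc k.
Proof. by []. Qed.
Lemma pclass_rel a b : rel a b -> pclass a = pclass b.
Proof. by move=> ab; apply/pclassP; exact: tcong_rel. Qed.

Lemma palg_ind (P : palg -> Prop) :
  (forall x, P (pgen x)) -> (forall k : K, P (algc k)) ->
  (forall x y, P x -> P y -> P (x + y)) ->
  (forall x y, P x -> P y -> P (x * y)) -> forall x, P x.
Proof.
move=> Pg Ps Pa Pm x; rewrite -[x]preprK.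
elim: (prepr x) => [y|k|a Pa' b Pb|a Pa' b Pb]; first exact: Pg.
- by rewrite pclass_scal.
- by rewrite pclass_add; exact: Pa.
- by rewrite pclass_mul; exact: Pm.
Qed.

End Presentation.

(* The nodes are ['I_r]; [cartan i j] is c_ij = 2(alpha_i,alpha_j)/(alpha_i,alpha_i)
   and [symd i] is d_i, so that (alpha_i,alpha_j) = d_i c_ij.  A vector of
   ['rV[int]_r] is read in the basis of the simple roots (element of Q) or in the
   basis of the fundamental coweights (coweight). *)
Record simple_datum (r : nat) := SimpleDatum {
  cartan : 'M[int]_r;
  symd : 'I_r -> nat;
  rank_gt0 : (0 < r)%N;
  cartan_diag : forall i, cartan i i = 2;
  cartan_offdiag : forall i j, i != j -> cartan i j <= 0;
  cartan_sym : forall i j, (symd i)%:Z * cartan i j = (symd j)%:Z * cartan j i;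
  cartan_posdef : forall x : 'rV[int]_r, x != 0 ->
    0 < \sum_i \sum_j x 0 i * x 0 j * ((symd i)%:Z * cartan i j);
  cartan_connected : forall J : {set 'I_r}, (0 < #|J|)%N -> (#|J| < r)%N ->
    exists i j, [/\ i \in J, j \notin J & cartan i j != 0];
  symd_gt0 : forall i, (0 < symd i)%N;
  symd_coprime : \big[gcdn/0%N]_i symd i = 1%N
}.

Section Weights.
Variable r : nat.
Definition alpha (i : 'I_r) : 'rV[int]_r := delta_mx 0 i.
Definition varpi (i : 'I_r) : 'rV[int]_r := delta_mx 0 i.
Definition pairing (mu beta : 'rV[int]_r) : int := \sum_i mu 0 i * beta 0 i.
End Weights.

Section Dij.
Variables (K : numClosedFieldType) (r : nat) (g : simple_datum r).
Definition dnode (i : 'I_r) : K := (symd g i)%:R.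
Definition dpair (i j : 'I_r) : K := ((symd g i)%:Z * cartan g i j)%:~R / 2%:R.
End Dij.

(* [GX true i n], [GX false i n], [GXi i p] stand for x^+_{i,n}, x^-_{i,n}, xi_{i,p}. *)
Inductive ygen (r : nat) :=
| GX of bool & 'I_r & nat
| GXi of 'I_r & int.

Section Yangian.
Variables (K : numClosedFieldType) (r : nat) (g : simple_datum r) (mu : 'rV[int]_r).

Local Notation tm := (term K (ygen r)).
Local Notation "'x_" := (fun (s : bool) (i : 'I_r) (n : nat) => tgen (GX s i n) : tm).
Local Notation "'xi_" := (fun (i : 'I_r) (p : int) => tgen (GXi i p) : tm).
Local Notation sg s := (if s then 1 else -1 : K).

Inductive yrel : tm -> tm -> Prop :=
| yrel_xixi i p j q :
    yrel (tcomm ('xi_ i p) ('xi_ j q)) (tscal 0)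
| yrel_xx i m j n :
    yrel (tcomm ('x_ true i m) ('x_ false j n))
         (if i == j then 'xi_ i (m + n)%N%:Z else tscal 0)
| yrel_xix s i p j n :
    yrel (tsub (tcomm ('xi_ i (p + 1)) ('x_ s j n)) (tcomm ('xi_ i p) ('x_ s j n.+1)))
         (tscale (sg s * dpair K g i j) (tanti ('xi_ i p) ('x_ s j n)))
| yrel_xsxs s i m j n :
    yrel (tsub (tcomm ('x_ s i m.+1) ('x_ s j n)) (tcomm ('x_ s i m) ('x_ s j n.+1)))
         (tscale (sg s * dpair K g i j) (tanti ('x_ s i m) ('x_ s j n)))
| yrel_serre s i j : i != j ->
    yrel (iter `|1 - cartan g i j|%N (tcomm ('x_ s i 0%N)) ('x_ s j 0%N)) (tscal 0)
| yrel_lead i :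
    yrel ('xi_ i (- pairing mu (alpha i) - 1)) (tscal 1)
| yrel_low i p : p < - pairing mu (alpha i) - 1 ->
    yrel ('xi_ i p) (tscal 0).

Definition Yangian : pzAlgType K := PzAlg.clone K (palg yrel) _.

Definition yx (s : bool) (i : 'I_r) (n : nat) : Yangian := pgen yrel (GX s i n).
Definition yxi (i : 'I_r) (p : int) : Yangian := pgen yrel (GXi i p).

Inductive Yzero : Yangian -> Prop :=
| Yzero_xi i p : Yzero (yxi i p)
| Yzero_scal (k : K) : Yzero (algc k)
| Yzero_add x y : Yzero x -> Yzero y -> Yzero (x + y)
| Yzero_mul x y : Yzero x -> Yzero y -> Yzero (x * y).

(* The Q-grading: [Yhom gamma] is the span of the monomials of weight gamma. *)
Inductive Yhom : 'rV[int]_r -> Yangian -> Prop :=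
| Yhom_xp i n : Yhom (alpha i) (yx true i n)
| Yhom_xm i n : Yhom (- alpha i) (yx false i n)
| Yhom_xi i p : Yhom 0 (yxi i p)
| Yhom_one : Yhom 0 1
| Yhom_zero gamma : Yhom gamma 0
| Yhom_add gamma x y : Yhom gamma x -> Yhom gamma y -> Yhom gamma (x + y)
| Yhom_scale gamma (k : K) x : Yhom gamma x -> Yhom gamma (algc k * x)
| Yhom_mul gamma delta x y : Yhom gamma x -> Yhom delta y -> Yhom (gamma + delta) (x * y).

End Yangian.

(* [fps A] is the ring of sequences of A with the Cauchy product.  The formal
   variable depends on the context: z^-1 (or w^-1) for A_i, S_i, and w for the
   subring [wpoly A] = A[w] of the finitely supported sequences. *)
Record fps (A : Type) := Fps { fcoef :> nat -> A }.

Section FpsRing.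
Variable A : pzRingType.
Implicit Types f g h : fps A.

HB.instance Definition _ := gen_eqMixin (fps A).
HB.instance Definition _ := gen_choiceMixin (fps A).

Lemma fpsP f g : (forall n, f n = g n) -> f = g.
Proof. by case: f g => f [g] /= /funext ->. Qed.

Let fadd f g := Fps (fun n => f n + g n).
Let fopp f := Fps (fun n => - f n).
Let fzero : fps A := Fps (fun=> 0).
Let fone : fps A := Fps (fun n => (n == 0%N)%:R).
Let fmul f g := Fps (fun n => \sum_(i < n.+1) f i * g (n - i)%N).

Let faddA : associative fadd.
Proof. by move=> f g h; apply: fpsP => n /=; rewrite addrA. Qed.
Let faddC : commutative fadd.
Proof. by move=> f g; apply: fpsP => n /=; rewrite addrC. Qed.
Let fadd0 : left_id fzero fadd.
Proof. by move=> f; apply: fpsP => n /=; rewrite add0r. Qed.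
Let faddN : left_inverse fzero fopp fadd.
Proof. by move=> f; apply: fpsP => n /=; rewrite addNr. Qed.

HB.instance Definition _ := GRing.isZmodule.Build (fps A) faddA faddC fadd0 faddN.

Let fmul_rev f g n : fmul f g n = \sum_(i < n.+1) f (n - i)%N * g i.
Proof.
rewrite /= (reindex_inj rev_ord_inj) /=.
by apply: eq_bigr => j _; rewrite (sub_ordK j).
Qed.

Let fmulA : associative fmul.
Proof.
move=> p q r; apply: fpsP=> i; rewrite [RHS]fmul_rev /=.
pose coef3 j k := p j * (q (i - j - k)%N * r k).
transitivity (\sum_(j < i.+1) \sum_(k < i.+1 | (k <= i - j)%N) coef3 j k).
  apply: eq_bigr => /= j _; rewrite -[\sum_(i0 < _) _]/(fmul q r _) fmul_rev big_distrr /=.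
  by rewrite (big_ord_narrow_leq (leq_subr _ _)).
rewrite (exchange_big_dep predT) //=; apply: eq_bigr => k _.
transitivity (\sum_(j < i.+1 | (j <= i - k)%N) coef3 j k).
  apply: eq_bigl => j; rewrite -ltnS -(ltnS j) -!subSn ?leq_ord //.
  by rewrite -subn_gt0 -(subn_gt0 j) -!subnDA addnC.
rewrite (big_ord_narrow_leq (leq_subr _ _)) big_distrl /=.
by apply: eq_bigr => j _; rewrite /coef3 -!subnDA addnC mulrA.
Qed.
Let fmul1l : left_id fone fmul.
Proof.
move=> f; apply: fpsP => n /=; rewrite big_ord_recl /= subn0 mul1r big1 ?addr0//.
by move=> i _; rewrite mul0r.
Qed.
Let fmul1r : right_id fone fmul.
Proof.
move=> f; apply: fpsP => n; rewrite fmul_rev big_ord_recl /= subn0 mulr1 big1 ?addr0//.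
by move=> i _; rewrite mulr0.
Qed.
Let fmulDl : left_distributive fmul +%R.
Proof.
by move=> f g h; apply: fpsP => n /=; rewrite -big_split; apply: eq_bigr => i _; rewrite mulrDl.
Qed.
Let fmulDr : right_distributive fmul +%R.
Proof.
by move=> f g h; apply: fpsP => n /=; rewrite -big_split; apply: eq_bigr => i _; rewrite mulrDr.
Qed.

HB.instance Definition _ :=
  GRing.Zmodule_isPzRing.Build (fps A) fmulA fmul1l fmul1r fmulDl fmulDr.

Lemma fcoefD f g n : (f + g) n = f n + g n. Proof. by []. Qed.
Lemma fcoefN f n : (- f) n = - f n. Proof. by []. Qed.
Lemma fcoef0 n : (0 : fps A) n = 0. Proof. by []. Qed.
Lemma fcoef1 n : (1 : fps A) n = (n == 0%N)%:R. Proof. by []. Qed.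
Lemma fcoefM f g n : (f * g) n = \sum_(i < n.+1) f i * g (n - i)%N.
Proof. by []. Qed.

Definition fps_finite : pred (fps A) :=
  fun f => `[< exists N, forall n, (N <= n)%N -> f n = 0 >].

Let fps_finite_closed : subring_closed fps_finite.
Proof.
split=> [|f h /asboolP[N fN] /asboolP[M hM]|f h /asboolP[N fN] /asboolP[M hM]]; apply/asboolP.
- by exists 1%N; case.
- exists (maxn N M) => n; rewrite geq_max => /andP[Nn Mn].
  by rewrite fcoefD fcoefN fN // hM // subr0.
- exists (N + M)%N => n NMn; rewrite fcoefM big1 // => i _.
  have [Ni|iN] := leqP N i; first by rewrite fN // mul0r.
  by rewrite (hM (n - i)%N) ?mulr0 // leq_subRL ?leq_ord//; rewrite (leq_trans _ NMn)// leq_add2r ltnW.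
Qed.

Record wpoly := WPoly { wcoef :> fps A; _ : wcoef \in fps_finite }.
HB.instance Definition _ := [isSub for wcoef].
HB.instance Definition _ := [Choice of wpoly by <:].
HB.instance Definition _ := GRing.SubChoice_isSubPzRing.Build _ _ wpoly fps_finite_closed.

End FpsRing.

Section FpsAlg.
Variables (K : pzRingType) (A : pzAlgType K).

Let fc (k : K) : fps A := Fps (fun n => if n == 0%N then algc k else 0).
Let fcB : zmod_morphism fc.
Proof.
move=> k l; apply: fpsP => -[|n]; rewrite fcoefD fcoefN /= ?subr0//.
by rewrite rmorphB.
Qed.
Let fcM : monoid_morphism fc.
Proof.
split=> [|k l]; apply: fpsP => n.
  by rewrite fcoef1 /=; case: n => //=; rewrite rmorph1.
rewrite fcoefM big_ord_recl big1 /= ?addr0 ?subn0; last by move=> i _; rewrite mul0r.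
by case: n => [|n] /=; rewrite ?mulr0// rmorphM.
Qed.
Let fcC (k : K) (f : fps A) : fc k * f = f * fc k.
Proof.
apply: fpsP => n; rewrite fcoefM big_ord_recl big1 /= ?addr0 ?subn0; last first.
  by move=> i _; rewrite mul0r.
rewrite big_ord_recr big1 /= ?add0r ?subnn ?algcC// => i _.
by rewrite subn_eq0 leqNgt ltn_ord /= mulr0.
Qed.
HB.instance Definition _ := isPzAlg.Build K (fps A) fcB fcM fcC.

Let wc_subproof (k : K) : (algc k : fps A) \in @fps_finite A.
Proof. by apply/asboolP; exists 1%N; case. Qed.
Let wc (k : K) : wpoly A := WPoly (wc_subproof k).
Let wcB : zmod_morphism wc.
Proof. by move=> k l; apply: val_inj; rewrite /= rmorphB. Qed.
Let wcM : monoid_morphism wc.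
Proof. by split=> [|k l]; apply: val_inj; rewrite /= ?rmorph1 ?rmorphM. Qed.
Let wcC (k : K) (f : wpoly A) : wc k * f = f * wc k.
Proof. by apply: val_inj; rewrite /= algcC. Qed.
HB.instance Definition _ := isPzAlg.Build K (wpoly A) wcB wcM wcC.

End FpsAlg.

Section Series.
Variables (K : numClosedFieldType) (A : pzAlgType K).

(* Inverse of a series with constant term 1, as a geometric series: powers
   beyond the n-th do not contribute to the coefficient of index n. *)
Definition fps_inv (f : fps A) : fps A :=
  Fps (fun n => (\sum_(k < n.+1) (1 - f) ^+ k) n).

(* [fps_exp f] is meaningful for f with constant term 0, [fps_log f] for f with
   constant term 1. *)
Definition fps_exp (f : fps A) : fps A :=
  Fps (fun n => \sum_(k < n.+1) algc (k`!%:R^-1 : K) * (f ^+ k) n).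
Definition fps_log (f : fps A) : fps A :=
  Fps (fun n => \sum_(1 <= k < n.+1)
                   algc ((-1) ^+ k.-1 / k%:R : K) * ((f - 1) ^+ k) n).

(* f(z) |-> f(z + b), where f is a series in z^-1:
   (z + b)^-m = \sum_k 'C(m + k - 1, k) (-b)^k z^(-m-k). *)
Definition fps_shift (b : K) (f : fps A) : fps A :=
  Fps (fun n => \sum_(m < n.+1)
                   algc ('C(n.-1, n - m)%:R * (- b) ^+ (n - m)) * f m).

Definition fps_exprz (f : fps A) (b : int) : fps A :=
  match b with Posz n => f ^+ n | Negz n => fps_inv f ^+ n.+1 end.

End Series.

(* G(z)^x = exp(x log G(z)) *)
Definition fps_pow (K : numClosedFieldType) (A : pzAlgType K) (G : fps K^o) (x : A) : fps A :=
  fps_exp (Fps (fun n => algc (fps_log G n : K) * x)).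

Section SSeries.
Variables (K : numClosedFieldType) (r : nat) (g : simple_datum r) (mu : 'rV[int]_r).
Local Notation Y := (Yangian K g mu).
Local Notation d := (dnode K g).

Definition xibar (i : 'I_r) : fps Y :=
  Fps (fun k => yxi K g mu i (k%:Z - 1 - pairing mu (alpha i))).

Definition one_plus_Yzero (f : fps Y) : Prop := f 0%N = 1 /\ forall n, Yzero (f n).

Definition is_GKLO (A : 'I_r -> fps Y) : Prop :=
  (forall i, one_plus_Yzero (A i)) /\
  forall i, xibar i =
    fps_inv (A i * fps_shift (- d i) (A i)) *
    \prod_(j < r | cartan g j i < 0)
      \prod_(1 <= t < `|cartan g j i|%N.+1)
        fps_shift (- dpair K g i j - t%:R * d j) (A j).

(* A_i(z) = exp(\sum_m d_i a_{i,m} z^(-m-1)) *)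
Definition gklo_coef (A : 'I_r -> fps Y) (i : 'I_r) (m : nat) : Y :=
  algc (d i)^-1 * fps_log (A i) m.+1.

(* z / (z + b) = \sum_n (-b)^n z^-n *)
Definition zratio (b : K) : fps K^o := Fps (fun n => (- b) ^+ n).

Definition is_Sseries (A S : 'I_r -> fps Y) : Prop :=
  forall i, one_plus_Yzero (S i) /\
    fps_shift (d i) (S i) =
      S i * A i * fps_pow (zratio (d i)) (gklo_coef A i 0).

End SSeries.

Definition is_poly_lweight (K : numClosedFieldType) (r : nat) (zeta : 'rV[int]_r)
    (p : 'I_r -> {poly K}) : Prop :=
  forall i, p i \is monic /\ (size (p i))%:Z = pairing zeta (alpha i) + 1.

Definition proots (K : numClosedFieldType) (q : {poly K}) : seq K :=
  sval (closed_field_poly_normal q).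

(* The S_i have coefficients in the commutative subalgebra Y^0, so that the order
   of the factors is immaterial. *)
Definition Spoly (K : numClosedFieldType) (r : nat) (g : simple_datum r)
    (mu : 'rV[int]_r) (p : 'I_r -> {poly K}) (S : 'I_r -> fps (Yangian K g mu)) :
    fps (Yangian K g mu) :=
  \prod_i \prod_(a <- proots (p i)) fps_shift a (S i).

(* A Laurent series in w^-1 is a function c : int -> M vanishing at all large
   arguments, [c k] being the coefficient of w^k. *)
Definition lbounded (M : zmodType) (c : int -> M) : Prop :=
  exists N : int, forall n, N < n -> c n = 0.

Definition lact (A : pzRingType) (V : lmodType A) (c : int -> A) (h : int -> V) :
    int -> V :=
  fun n => \sum_(k \in [set: int]) c k *: h (n - k).

Definition lau_of_wpoly (A : pzRingType) (P : wpoly A) : int -> A :=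
  fun k => match k with Posz n => P n | Negz _ => 0 end.
Definition lau_of_fps (A : pzRingType) (f : fps A) : int -> A :=
  fun k => match - k with Posz n => f n | Negz _ => 0 end.

Section ScalarLaurent.
Variable K : numClosedFieldType.

Definition lmul (c c' : int -> K) : int -> K :=
  fun n => \sum_(k \in [set: int]) c k * c' (n - k).
Definition lone : int -> K := fun n => (n == 0)%:R.

(* [lexp q b] is q(w)^b expanded in K((w^-1)), for b in Z: if q has degree n and
   leading coefficient c, then q = c w^n q~ where [rev_fps q] is the series q~ in
   w^-1, with constant term 1. *)
Definition rev_fps (q : {poly K}) : fps K^o :=
  Fps (fun m => if (m < size q)%N then q`_((size q).-1 - m) / lead_coef q else 0).
Definition lexp (q : {poly K}) (b : int) : int -> K :=
  fun k => lead_coef q ^ b *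
    match (size q).-1%:Z * b - k with
    | Posz m => fps_exprz (rev_fps q) b m
    | Negz _ => 0
    end.

End ScalarLaurent.

Section RootGraded.
Variables (K : numClosedFieldType) (r : nat) (g : simple_datum r) (mu : 'rV[int]_r).
Local Notation Y := (Yangian K g mu).
Local Notation Q := 'rV[int]_r.

Definition is_decomp (V : lmodType Y) (piece : Q -> set V) (v : V) (c : Q -> V) : Prop :=
  [/\ forall beta, piece beta (c beta),
      finite_set [set beta | c beta != 0] &
      v = \sum_(beta \in [set: Q]) c beta].

Record root_grading (V : lmodType Y) := RootGrading {
  piece :> Q -> set V;
  piece0 : forall beta, piece beta 0;
  pieceD : forall beta u v, piece beta u -> piece beta v -> piece beta (u + v);
  pieceZ : forall beta (k : K) v, piece beta v -> piece beta ((algc k : Y) *: v);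
  piece_decomp : forall v, exists! c, is_decomp piece v c;
  piece_act : forall gamma beta (y : Y) v,
    Yhom gamma y -> piece beta v -> piece (gamma + beta) (y *: v)
}.

Variables (V : lmodType Y) (VQ : root_grading V).

Definition component (beta : Q) (v : V) : V := sval (cid (piece_decomp VQ v)) beta.

Definition lpiece (beta : Q) (h : int -> V) : Prop :=
  lbounded h /\ forall n, VQ beta (h n).

(* V^w, the sum of the subspaces V_(beta)((w^-1)). *)
Inductive Vw_span : (int -> V) -> Prop :=
| Vw_mem beta h : lpiece beta h -> Vw_span h
| Vw_zero : Vw_span 0
| Vw_add h1 h2 : Vw_span h1 -> Vw_span h2 -> Vw_span (h1 + h2).

Definition Vw_pred : pred (int -> V) := fun h => `[< Vw_span h >].

Lemma pieceN beta v : VQ beta v -> VQ beta (- v).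
Proof.
by move=> /(pieceZ (-1)); rewrite rmorphN rmorph1 scaleN1r.
Qed.

Let Vw_closed : zmod_closed Vw_pred.
Proof.
split=> [|h1 h2 /asboolP sh1 /asboolP sh2]; apply/asboolP; first exact: Vw_zero.
apply: Vw_add => //; elim: sh2 => [beta h [[N hN] hb]||h h' _ IH _ IH'].
- apply: (@Vw_mem beta); split=> [|n]; last exact: pieceN.
  by exists N => n Nn; change (- (h n) = 0); rewrite hN ?oppr0.
- by rewrite oppr0; exact: Vw_zero.
- by rewrite opprD; exact: Vw_add.
Qed.

Record Vw := MkVw { vseries :> int -> V; _ : vseries \in Vw_pred }.
HB.instance Definition _ := [isSub for vseries].
HB.instance Definition _ := [Choice of Vw by <:].
HB.instance Definition _ := GRing.SubChoice_isSubZmodule.Build _ _ Vw Vw_closed.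

Lemma lact_wpolyE (P : wpoly Y) N (h : int -> V) n :
  (forall k, (N <= k)%N -> P k = 0) ->
  lact (lau_of_wpoly P) h n = \sum_(k < N) P k *: h (n - k%:Z).
Proof.
move=> PN; rewrite -(big_mkord predT (fun k => P k *: h (n - k%:Z))) /lact.
have u : uniq [seq Posz k | k <- index_iota 0 N].
  by rewrite map_inj_uniq ?iota_uniq// => i j [].
rewrite (fsbigE _ _ u) //; last first.
  move=> [k|k] _ kN /=; last by rewrite scale0r.
  rewrite PN ?scale0r// leqNgt; apply: contra kN => kN.
  by apply/mapP; exists k; rewrite ?mem_index_iota.
rewrite big_map; apply: eq_bigl => k; by rewrite in_setT.
Qed.

Lemma wpoly_bound (P : wpoly Y) : exists N, forall k, (N <= k)%N -> P k = 0.
Proof. by case: P => f /= /asboolP. Qed.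

Lemma lact_scale_Vw (y : Y) h : Vw_span h -> Vw_span (fun n => y *: h n).
Proof.
have hom gamma (x : Y) : Yhom gamma x -> forall f, Vw_span f -> Vw_span (fun n => x *: f n).
  move=> xh f; elim=> [beta f' [[N f'N] fb]||f1 f2 _ IH1 _ IH2].
  - apply: (@Vw_mem (gamma + beta)); split=> [|n]; last exact: piece_act.
    by exists N => n Nn; rewrite f'N ?scaler0.
  - rewrite (_ : (fun n => _) = 0); first exact: Vw_zero.
    by apply/funext => n; rewrite scaler0.
  - rewrite (_ : (fun n => _) = (fun n => x *: f1 n) + (fun n => x *: f2 n)).
      exact: Vw_add.
    by apply/funext => n; rewrite [LHS]scalerDr.
elim/palg_ind: y h => [[[] i n|i p]|k|x y Px Py|x y Px Py] h hw.
- exact: hom (Yhom_xp _ _ _ i n) _ hw.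
- exact: hom (Yhom_xm _ _ _ i n) _ hw.
- exact: hom (Yhom_xi _ _ _ i p) _ hw.
- by have := hom _ _ (Yhom_scale k (Yhom_one K g mu)) _ hw; rewrite mulr1.
- rewrite (_ : (fun n => _) = (fun n => x *: h n) + (fun n => y *: h n)).
    by apply: Vw_add; [exact: Px|exact: Py].
  by apply/funext => n; rewrite [LHS]scalerDl.
- rewrite (_ : (fun n => _) = (fun n => x *: (y *: h n))).
    exact: (Px _ (Py _ hw)).
  by apply/funext => n; rewrite [RHS]scalerA.
Qed.

Lemma lact_shift_Vw (k : int) h : Vw_span h -> Vw_span (fun n => h (n - k)).
Proof.
elim=> [beta f [[N fN] fb]||f1 f2 _ IH1 _ IH2].
- apply: (@Vw_mem beta); split=> // ; exists (N + k) => n Nn.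
  by rewrite fN // ltrBrDr.
- exact: Vw_zero.
- exact: Vw_add IH1 IH2.
Qed.

Let wact_subproof (P : wpoly Y) (h : Vw) : lact (lau_of_wpoly P) h \in Vw_pred.
Proof.
case: h => h /= /asboolP hw; apply/asboolP; have [N PN] := wpoly_bound P.
rewrite (_ : lact _ h = \sum_(k < N) (fun n => P k *: h (n - k%:Z))).
  elim/big_ind: _ => [||k _]; [exact: Vw_zero|exact: Vw_add|].
  exact: (lact_scale_Vw _ (lact_shift_Vw _ hw)).
by apply/funext => n; rewrite fct_sumE; exact: lact_wpolyE.
Qed.

Definition wact (P : wpoly Y) (h : Vw) : Vw := MkVw (wact_subproof P h).

Let wactA (P P' : wpoly Y) h : wact P (wact P' h) = wact (P * P') h.
Proof.
have [N PN] := wpoly_bound P; have [M PM] := wpoly_bound P'.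
have [L PL] := wpoly_bound (P * P').
pose B := (L + N + M)%N.
have PB k : (B <= k)%N -> P k = 0.
  by move=> Bk; apply: PN; apply: leq_trans Bk; rewrite /B addnAC leq_addl.
have P'B k : (B <= k)%N -> P' k = 0.
  by move=> Bk; apply: PM; apply: leq_trans Bk; rewrite leq_addl.
have PPB k : (B + B <= k)%N -> (P * P')%R k = 0.
  by move=> Bk; apply: PL; apply: leq_trans Bk; rewrite /B -!addnA leq_addr.
apply: val_inj; apply/funext => n /=.
rewrite (lact_wpolyE _ _ PPB).
transitivity (\sum_(i < B + B) P i *: lact (lau_of_wpoly P') h (n - i%:Z)).
  by apply: lact_wpolyE => k Bk; apply: PB; exact: leq_trans (leq_addr _ _) Bk.
transitivity (\sum_(i < B + B) \sum_(k < B + B | (i <= k)%N)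
    (P i * P' (k - i)%N) *: (h : int -> V) (n - k%:Z)); last first.
  rewrite (exchange_big_dep predT) //=; apply: eq_bigr => k _.
  rewrite scaler_suml (big_ord_widen_cond _ predT (fun i => (P i * P' (k - i)%N) *: (h : int -> V) (n - k%:Z)) (ltn_ord k)).
  by apply: eq_bigl => i; rewrite /= ltnS.
apply: eq_bigr => i _; have [Bi|iB] := leqP B i.
  by rewrite PB // scale0r big1 // => k _; rewrite mul0r scale0r.
rewrite (lact_wpolyE _ _ P'B) scaler_sumr.
rewrite -(big_mkord predT (fun k => P i *: (P' k *: (h : int -> V) (n - i%:Z - k%:Z)))).
rewrite -(big_mkord (fun k => (i <= k)%N) (fun k => (P i * P' (k - i)%N) *: (h : int -> V) (n - k%:Z))).
set F := (fun k => (P i * P' (k - i)%N) *: (h : int -> V) (n - k%:Z)).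
have iBB : (i <= B + B)%N by rewrite ltnW // ltn_addr.
rewrite [RHS](@big_cat_nat _ _ _ i) //= (_ : \sum_(0 <= k < i | (i <= k)%N) F k = 0); last first.
  by rewrite big_nat_cond big1 // => k /andP[/andP[_ ki]]; rewrite leqNgt ki.
have -> : \sum_(i <= k < B + B | (i <= k)%N) F k = \sum_(0 <= k < B + B - i) F (k + i)%N.
  by rewrite -{1}[nat_of_ord i]add0n big_addn; apply: eq_bigl => k; rewrite leq_addl.
rewrite add0r.
have BBi : (B <= B + B - i)%N by rewrite -addnBA ?leq_addr// ltnW.
rewrite [RHS](@big_cat_nat _ _ _ B) //= [X in _ = _ + X](_ : _ = 0); last first.
  by rewrite big_nat_cond big1 // => k /andP[/andP[Bk _] _]; rewrite /F addnK P'B // mulr0 scale0r.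
rewrite addr0; apply: eq_bigr => k _.
by rewrite /F addnK scalerA PoszD opprD addrA addrAC.
Qed.

Let wact1 : left_id 1 wact.
Proof.
move=> h; apply: val_inj; apply/funext => n /=.
rewrite (@lact_wpolyE _ 1) => [|[]//].
by rewrite big_ord1 fcoef1 scale1r subr0.
Qed.

Let wactDr : right_distributive wact +%R.
Proof.
move=> P h h'; have [N PN] := wpoly_bound P.
apply: val_inj; apply/funext => n /=.
transitivity (lact (lau_of_wpoly P) h n + lact (lau_of_wpoly P) h' n); last by [].
rewrite !(lact_wpolyE _ _ PN) -big_split.
by apply: eq_bigr => k _; exact: scalerDr.
Qed.

Let wactDl h : {morph wact^~ h : P P' / P + P'}.
Proof.
move=> P P'; have [N PN] := wpoly_bound P; have [M PM] := wpoly_bound P'.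
have PB k : (N + M <= k)%N -> P k = 0.
  by move=> Bk; apply: PN; apply: leq_trans Bk; rewrite leq_addr.
have P'B k : (N + M <= k)%N -> P' k = 0.
  by move=> Bk; apply: PM; apply: leq_trans Bk; rewrite leq_addl.
have PPB k : (N + M <= k)%N -> (P + P')%R k = 0.
  by move=> Bk; transitivity (P k + P' k); [by []|rewrite PB // P'B // addr0].
apply: val_inj; apply/funext => n /=.
transitivity (lact (lau_of_wpoly P) h n + lact (lau_of_wpoly P') h n); last by [].
rewrite (lact_wpolyE _ _ PPB) (lact_wpolyE _ _ PB) (lact_wpolyE _ _ P'B).
by rewrite -big_split; apply: eq_bigr => k _; exact: scalerDl.
Qed.

HB.instance Definition _ :=
  GRing.Zmodule_isLmodule.Build (wpoly Y) Vw wactA wact1 wactDr wactDl.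

End RootGraded.

Section CompletedTensor.
Variables (K : numClosedFieldType) (r : nat) (g : simple_datum r) (mu : 'rV[int]_r).
Variable p : 'I_r -> {poly K}.
Local Notation Y := (Yangian K g mu).

(* \prod_i p_i(-w)^(- <varpi_i, beta>) in K((w^-1)) *)
Definition Dscalar (beta : 'rV[int]_r) : int -> K :=
  \big[@lmul K/lone K]_i lexp (p i \Po (- 'X)) (- pairing (varpi i) beta).

Definition Dop (V : lmodType Y) (VQ : root_grading V) (h : int -> V) : int -> V :=
  \sum_(beta \in [set: 'rV[int]_r])
    lact (fun k => algc (Dscalar beta k) : Y) (fun n => component VQ beta (h n)).

(* Formal series \sum_n f_n z^(-n-1) are functions n |-> f_n on int. *)
Definition xser (s : bool) (i : 'I_r) : int -> Y :=
  fun n => match n with Posz m => yx K g mu s i m | Negz _ => 0 end.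
Definition xiser (i : 'I_r) : int -> Y := yxi K g mu i.

Definition princ (M : zmodType) (f : int -> M) : int -> M :=
  fun n => if 0 <= n then f n else 0.

Let wconst_subproof (y : Y) :
  Fps (fun n => if n == 0%N then y else 0) \in @fps_finite Y.
Proof. by apply/asboolP; exists 1%N; case. Qed.
Definition wconst (y : Y) : wpoly Y := WPoly (wconst_subproof y).

Let wpol_subproof (q : {poly K}) : Fps (fun n => algc q`_n : Y) \in @fps_finite Y.
Proof. by apply/asboolP; exists (size q) => n qn /=; rewrite nth_default// rmorph0. Qed.
Definition wpol (q : {poly K}) : wpoly Y := WPoly (wpol_subproof q).

(* Product of a polynomial in z over K[w] with a series in z over Y[w]. *)
Definition zmul (P : {poly {poly K}}) (f : int -> wpoly Y) : int -> wpoly Y :=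
  fun n => \sum_(k < size P) wpol P`_k * f (n + k%:Z).

(* q(z - w), as a polynomial in z over K[w] *)
Definition zsubw (q : {poly K}) : {poly {poly K}} := map_poly polyC q \Po ('X - 'X%:P).

End CompletedTensor.

Section ShiftHoms.
Variables (K : numClosedFieldType) (r : nat) (g : simple_datum r) (mu zeta : 'rV[int]_r).
Variable p : 'I_r -> {poly K}.
Local Notation Y := (Yangian K g mu).
Local Notation Y' := (Yangian K g (mu + zeta)).

Definition is_shiftF (F : {rmorphism Y' -> wpoly Y}) : Prop :=
  (forall k : K, F (algc k) = algc k) /\
  forall i,
  [/\ F \o xser K g (mu + zeta) true i =1
        princ (zmul (zsubw (p i)) (@wconst K r g mu \o xser K g mu true i)),
      F \o xser K g (mu + zeta) false i =1 @wconst K r g mu \o xser K g mu false i &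
      F \o xiser K g (mu + zeta) i =1
        zmul (zsubw (p i)) (@wconst K r g mu \o xiser K g mu i)].

Definition is_shiftG (G : {rmorphism Y' -> wpoly Y}) : Prop :=
  (forall k : K, G (algc k) = algc k) /\
  forall i,
  [/\ G \o xser K g (mu + zeta) true i =1 @wconst K r g mu \o xser K g mu true i,
      G \o xser K g (mu + zeta) false i =1
        princ (zmul (zsubw (p i)) (@wconst K r g mu \o xser K g mu false i)) &
      G \o xiser K g (mu + zeta) i =1
        zmul (zsubw (p i)) (@wconst K r g mu \o xiser K g mu i)].

End ShiftHoms.

Definition pullback (A B : pzRingType) (f : {rmorphism A -> B}) (M : lmodType B) : Type := M.

Section Pullback.
Variables (A B : pzRingType) (f : {rmorphism A -> B}) (M : lmodType B).
HB.instance Definition _ := GRing.Zmodule.on (pullback f M).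

Let pscale (a : A) (m : pullback f M) : pullback f M := f a *: (m : M).
Let pscaleA a b m : pscale a (pscale b m) = pscale (a * b) m.
Proof. by rewrite /pscale scalerA rmorphM. Qed.
Let pscale1 : left_id 1 pscale.
Proof. by move=> m; rewrite /pscale rmorph1 scale1r. Qed.
Let pscaleDr : right_distributive pscale +%R.
Proof. by move=> a m m'; exact: scalerDr. Qed.
Let pscaleDl m : {morph pscale^~ m : a b / a + b}.
Proof. by move=> a b; rewrite /pscale rmorphD scalerDl. Qed.
HB.instance Definition _ :=
  GRing.Zmodule_isLmodule.Build A (pullback f M) pscaleA pscale1 pscaleDr pscaleDl.
End Pullback.

(* Main.v *)
From HB Require Import structures.
Require Import Defs.
From mathcomp Require Import all_boot all_order all_algebra.
From mathcomp Require Import all_classical reals complex.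
From mathcomp Require Import ring zify.

Set Implicit Arguments.
Unset Strict Implicit.
Unset Printing Implicit Defensive.

Import Order.TTheory GRing.Theory Num.Theory.
Local Open Scope ring_scope.

(** Write sigma for the shift x^+-_{k,n} |-> x^+-_{k,n+1}.  The operator S_p(w)
    intertwines the two actions, up to scalars, because it conjugates x^+-_k by an
    explicit fraction in w and sigma:
      S_p(w) p_k(sigma - w) x^+_k = p_k(- w) x^+_k S_p(w),
      S_p(w) p_k(- w) x^-_k = p_k(sigma - w) x^-_k S_p(w)    ([Spoly_conjugates]).
    Indeed p_k(sigma - w) x^+_{k,n} is the image of x^+_{k,n} under F, and
    p_k(sigma - w) x^-_{k,n} is the image of x^-_{k,n} under G.  The remaining scalar
    p_k(- w) is the ratio of the values of D on the weights beta and
    beta + alpha_k ([DE_addalpha]), and xi_k commutes with S_p(w) and preserves the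
    weight.

    The conjugation formula is obtained in three steps.  The relation between xi_i
    and x^+_k says that xi_i(z) conjugates x^+_k by the fraction
    (z - sigma + d_ik) / (z - sigma - d_ik), and x^-_k by the inverse one.  The
    equations that define the GKLO series then have the solution where A_k(z)
    conjugates x^+_k by (z - sigma) / (z - sigma + d_k) and where A_i commutes with
    x^+-_k for i different from k ([gklo_defect]).  Finally the difference equation
    for S_k has the solution where S_k(z) conjugates x^+_k by z / (z - sigma)
    ([S_defect]); the factor (z / (z + d_k))^a in it conjugates x^+_k by
    (z + d_k) / z, since [a, x^+_k] = - x^+_k.

    That A_i and S_i do behave like these solutions is proved by looking at the
    defect g (u x) - (v x) g of the relation saying that the series g conjugates x
    by v / u.  Lowest coefficients of defects add up under products of series,
    change sign under inversion, and are kept by translations of z.  In the equations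
    for A, the lowest coefficients in a given degree thus solve a homogeneous linear
    system whose matrix is the Cartan matrix, which is nonsingular.  In the equation
    for S_i, a first coefficient y z^-m has to satisfy m d_i y = 0.

    On V^w everything acts as some w^N f(w^-1) with f a power series over the
    shifted Yangian, on each V_(beta)((w^-1)) also in the case of D.  Hence the
    module identities reduce to the identities of power series above, and T is
    inverted by inverting S_p(w), whose constant term is 1, and the scalars of D. *)

(** * Formal power series *)

Lemma sum_triangle (V : nmodType) (t : nat -> nat -> V) N :
  \sum_(k < N) \sum_(i < k.+1) t i (k - i)%N = \sum_(i < N) \sum_(j < N - i) t i j.
Proof.
elim: N => [|N IH]; first by rewrite !big_ord0.
rewrite big_ord_recr IH /= [RHS]big_ord_recr /= subSnn big_ord1.
rewrite big_ord_recr /= subnn addrA; congr (_ + _).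
rewrite -big_split; apply: eq_bigr => i _ /=.
by rewrite subSn ?big_ord_recr // ltnW.
Qed.

Section FpsCoef.
Variable A : pzRingType.
Implicit Types f g : fps A.

Lemma fcoef_sum I (s : seq I) (P : pred I) (F : I -> fps A) n :
  (\sum_(i <- s | P i) F i) n = \sum_(i <- s | P i) F i n.
Proof. exact: (big_morph (fun f : fps A => f n)). Qed.

Lemma fcoefB f g n : (f - g) n = f n - g n.
Proof. by []. Qed.

Lemma fcoefMn f k n : (f *+ k) n = f n *+ k.
Proof. by elim: k => [//|k IH]; rewrite !mulrS fcoefD IH. Qed.

Lemma fcoef0M f g : (f * g) 0%N = f 0%N * g 0%N.
Proof. by rewrite fcoefM big_ord1. Qed.

Lemma fcoef1M f g : (f * g) 1%N = f 0%N * g 1%N + f 1%N * g 0%N.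
Proof. by rewrite fcoefM big_ord_recr big_ord1. Qed.

Lemma fcoefM_rev f g n : (f * g) n = \sum_(i < n.+1) f (n - i)%N * g i.
Proof.
rewrite fcoefM (reindex_inj rev_ord_inj) /=.
by apply: eq_bigr => j _; rewrite (sub_ordK j).
Qed.

Definition fconst (a : A) : fps A := Fps (fun n => if n == 0%N then a else 0).

Lemma fconstM a f n : (fconst a * f) n = a * f n.
Proof.
rewrite fcoefM big_ord_recl /= subn0 big1 ?addr0 // => i _.
by rewrite mul0r.
Qed.

Lemma Mfconst a f n : (f * fconst a) n = f n * a.
Proof.
rewrite fcoefM_rev big_ord_recl /= subn0 big1 ?addr0 // => i _.
by rewrite mulr0.
Qed.

(** The inverse z^-1 of the formal variable. *)
Definition zvar : fps A := Fps (fun n => (n == 1%N)%:R).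

Lemma zvarM f n : (zvar * f) n = if n is m.+1 then f m else 0.
Proof.
rewrite fcoefM big_ord_recl /= mul0r add0r.
case: n => [|n]; first by rewrite big_ord0.
rewrite big_ord_recl /= mul1r subSS subn0 big1 ?addr0 // => i _.
by rewrite mul0r.
Qed.

Lemma Mzvar f n : (f * zvar) n = if n is m.+1 then f m else 0.
Proof.
rewrite fcoefM_rev big_ord_recl /= mulr0 add0r.
case: n => [|n]; first by rewrite big_ord0.
rewrite big_ord_recl /= mulr1 subSS subn0 big1 ?addr0 // => i _.
by rewrite mulr0.
Qed.

Lemma zvarC f : zvar * f = f * zvar.
Proof. by apply: fpsP => n; rewrite zvarM Mzvar. Qed.

Lemma fcoefX_small f : f 0%N = 0 -> forall k n, (n < k)%N -> (f ^+ k) n = 0.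
Proof.
move=> f0; elim=> [//|k IH] n nk; rewrite exprS fcoefM big1 // => i _.
have [->|i0] := eqVneq (i : nat) 0%N; first by rewrite f0 mul0r.
have n0 : (0 < n)%N by rewrite (leq_trans _ (leq_ord i)) ?lt0n.
have nik : (n - i < k)%N.
  by rewrite (@leq_ltn_trans n.-1) // -?subn1 ?leq_sub2l ?lt0n // subn1 -ltnS prednK.
by rewrite IH ?mulr0.
Qed.

(** All uniqueness arguments below look at the first coefficient of a series
    that could fail to vanish. *)
Definition lead (m : nat) (f : fps A) (c : A) : Prop :=
  (forall k, (k < m)%N -> f k = 0) /\ f m = c.

Lemma leadD m f g a b : lead m f a -> lead m g b -> lead m (f + g) (a + b).
Proof.
move=> [f0 fm] [g0 gm]; split=> [k km|]; last by rewrite fcoefD fm gm.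
by rewrite fcoefD f0 ?g0 ?addr0.
Qed.

Lemma leadN m f a : lead m f a -> lead m (- f) (- a).
Proof.
move=> [f0 fm]; split=> [k km|]; last by rewrite fcoefN fm.
by rewrite fcoefN f0 ?oppr0.
Qed.

Lemma leadMl m f g a : g 0%N = 1 -> lead m f a -> lead m (g * f) a.
Proof.
move=> g0 [f0 fm]; split=> [k km|]; rewrite fcoefM_rev.
  by rewrite big1 // => i _; rewrite f0 ?mulr0 // (leq_ltn_trans (leq_ord i)).
rewrite big_ord_recr /= subnn g0 mul1r big1 ?add0r // => i _.
by rewrite f0 ?mulr0.
Qed.

Lemma leadMr m f g a : g 0%N = 1 -> lead m f a -> lead m (f * g) a.
Proof.
move=> g0 [f0 fm]; split=> [k km|]; rewrite fcoefM.
  by rewrite big1 // => i _; rewrite f0 ?mul0r // (leq_ltn_trans (leq_ord i)).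
rewrite big_ord_recr /= subnn g0 mulr1 big1 ?add0r // => i _.
by rewrite f0 ?mul0r.
Qed.

Lemma lead_uniq m f a b : lead m f a -> lead m f b -> a = b.
Proof. by move=> [_ <-] [_ <-]. Qed.

Lemma lead_eq0 f : (forall m c, lead m f c -> c = 0) -> f = 0.
Proof.
move=> fl; apply: fpsP => n; elim/ltn_ind: n => n IH.
by apply: (fl n (f n)); split.
Qed.

End FpsCoef.

Lemma fps_mulC (A : comPzRingType) (f g : fps A) : f * g = g * f.
Proof.
apply: fpsP => n; rewrite fcoefM fcoefM_rev; apply: eq_bigr => i _; exact: mulrC.
Qed.

Section FpsInv.
Variables (K : numClosedFieldType) (A : pzAlgType K).
Implicit Types f g : fps A.

(** The powers of 1 - f beyond the n-th have order greater than n, so that the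
    geometric series can be cut at any later place. *)
Lemma fps_invE f n N : f 0%N = 1 -> (n < N)%N ->
  fps_inv f n = (\sum_(k < N) (1 - f) ^+ k) n.
Proof.
move=> f0 nN; rewrite /= fcoef_sum fcoef_sum.
rewrite -(big_mkord predT (fun k => ((1 - f) ^+ k) n)).
rewrite -(big_mkord predT (fun k => ((1 - f) ^+ k) n)).
rewrite [RHS](@big_cat_nat _ _ _ n.+1) //= [X in _ = _ + X]big_nat_cond.
rewrite [X in _ = _ + X]big1 ?addr0 // => k /andP[/andP[nk _] _].
by rewrite fcoefX_small // fcoefB fcoef1 f0 subrr.
Qed.

Lemma fps_inv0 f : fps_inv f 0%N = 1.
Proof. by rewrite /= big_ord1 expr0. Qed.

Lemma fps_mulV f : f 0%N = 1 -> f * fps_inv f = 1.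
Proof.
move=> f0; apply: fpsP => n; rewrite fcoefM.
under eq_bigr => i _ do rewrite (@fps_invE _ _ n.+1) ?ltnS ?leq_subr //.
rewrite -fcoefM -{1}[f](subKr 1) -[1 - (1 - f)]opprB mulNr -subrX1 opprB.
by rewrite fcoefB fcoefX_small ?subr0 // fcoefB fcoef1 f0 subrr.
Qed.

Lemma fps_Vmul f : f 0%N = 1 -> fps_inv f * f = 1.
Proof.
move=> f0; have fg := fps_mulV f0; have gh := fps_mulV (fps_inv0 f).
have fE : f = fps_inv (fps_inv f) by rewrite -[LHS]mulr1 -gh mulrA fg mul1r.
by rewrite [X in _ * X]fE.
Qed.

End FpsInv.

(** * Scalar series, translation of the variable *)

Lemma algc_regE (K : comNzRingType) (k : K) : (algc k : K^o) = k.
Proof. by []. Qed.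

Section Scalars.
Variables (K : numClosedFieldType) (A : pzAlgType K).
Implicit Types (f g : fps A) (c d : fps K^o).

Definition fscal c : fps A := Fps (fun n => algc (c n : K)).

Lemma fscalC c f : fscal c * f = f * fscal c.
Proof.
by apply: fpsP => n; rewrite fcoefM fcoefM_rev; apply: eq_bigr => i _; exact: algcC.
Qed.

Lemma fscalCA c f g : f * (fscal c * g) = fscal c * (f * g).
Proof. by rewrite mulrA -fscalC mulrA. Qed.

Lemma fscalD c d : fscal (c + d) = fscal c + fscal d.
Proof. by apply: fpsP => n; rewrite fcoefD /= rmorphD. Qed.

Lemma fscalN c : fscal (- c) = - fscal c.
Proof. by apply: fpsP => n; rewrite fcoefN /= rmorphN. Qed.

Lemma fscalM c d : fscal (c * d) = fscal c * fscal d.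
Proof.
apply: fpsP => n; rewrite fcoefM /= rmorph_sum.
by apply: eq_bigr => i _; rewrite rmorphM.
Qed.

Lemma fscal1 : fscal 1 = 1.
Proof. by apply: fpsP => n /=; case: n => [|n] /=; rewrite ?rmorph1 ?rmorph0. Qed.

Lemma fscal_algc (k : K) : fscal (algc k) = algc k.
Proof. by apply: fpsP => -[|n] //=; rewrite rmorph0. Qed.

Lemma fscal_zvar : fscal (zvar K^o) = zvar A.
Proof. by apply: fpsP => n /=; rewrite rmorph_nat. Qed.

Lemma fcoef_algcM (k : K) f n : (algc k * f) n = algc k * f n.
Proof. exact: fconstM. Qed.

End Scalars.

Section Shift.
Variables (K : numClosedFieldType) (b : K).

(** (z + b)^-m, expanded in z^-1. *)
Let zpow (m : nat) : fps K^o :=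
  Fps (fun n => if (m <= n)%N then 'C(n.-1, n - m)%:R * (- b) ^+ (n - m) else 0).

Lemma zratioV : (1 + algc b * zvar K^o) * zratio b = 1.
Proof.
apply: fpsP => n; rewrite mulrDl mul1r fcoefD -mulrA fcoef_algcM zvarM fcoef1 /=.
case: n => [|n] /=; first by rewrite mulr0 addr0 expr0.
by rewrite exprS mulNr addNr.
Qed.

Let zpow0 : zpow 0 = 1.
Proof.
apply: fpsP => -[|n]; first by rewrite /= bin0 expr0 mul1r.
by rewrite /= subn0 bin_small // mul0r.
Qed.

Let zpowS m : zpow m.+1 = zvar K^o * zratio b * zpow m.
Proof.
suff kz : (1 + algc b * zvar K^o) * zpow m.+1 = zvar K^o * zpow m.
  have -> : zvar K^o * zratio b * zpow m = zratio b * (zvar K^o * zpow m).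
    by rewrite mulrA [zratio b * _]fps_mulC.
  by rewrite -kz mulrA [zratio b * _]fps_mulC zratioV mul1r.
apply: fpsP => n; rewrite mulrDl mul1r fcoefD -mulrA fcoef_algcM !zvarM.
case: n => [|n]; first by rewrite /= mulr0 addr0.
rewrite [zpow m.+1 n.+1]/= [zpow m n]/= [zpow m.+1 n]/= ltnS subSS.
have [mn|nm] := leqP m n; last by rewrite ltnNge (ltnW nm) mulr0 addr0.
have [m_n|nm] := ltnP m n; last first.
  have -> : m = n by apply/eqP; rewrite eqn_leq mn.
  by rewrite subnn !bin0 mulr0 addr0.
have -> : (n - m)%N = (n - m.+1).+1 by rewrite subnSK.
case: n m_n {mn} => [|n] // m_n; rewrite /= binS natrD exprS subSS.
rewrite mulrDl -addrA -[RHS]addr0; congr (_ + _).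
by rewrite algc_regE mulrCA mulNr; exact: addNr.
Qed.

Let zpowD m l : zpow m * zpow l = zpow (m + l).
Proof.
elim: m => [|m IH]; first by rewrite zpow0 mul1r.
by rewrite addSn !zpowS -IH mulrA.
Qed.

Variable A : pzAlgType K.
Implicit Types f g : fps A.

Let shiftE f n N : (n < N)%N ->
  fps_shift b f n = \sum_(m < N) algc (zpow m n : K) * f m.
Proof.
move=> nN /=.
rewrite -(big_mkord predT (fun m => algc (zpow m n : K) * f m)).
rewrite (@big_cat_nat _ _ _ n.+1) //= [X in _ = _ + X]big_nat_cond.
rewrite [X in _ = _ + X]big1 ?addr0 => [|m /andP[/andP[nm _] _]]; last first.
  by rewrite leqNgt nm rmorph0 mul0r.
by rewrite big_mkord; apply: eq_bigr => m _; rewrite leq_ord.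
Qed.

(** Substituting z + b for z is multiplicative because (z + b)^-m is the m-th
    power of z^-1 (z / (z + b)). *)
Lemma fps_shiftM f g : fps_shift b (f * g) = fps_shift b f * fps_shift b g.
Proof.
apply: fpsP => n; rewrite fcoefM.
transitivity (\sum_(i < n.+1) \sum_(m < n.+1) \sum_(l < n.+1)
    algc (zpow m i * zpow l (n - i)%N : K) * (f m * g l)); last first.
  apply: eq_bigr => i _; rewrite (@shiftE f i n.+1) // (@shiftE g _ n.+1) ?ltnS ?leq_subr //.
  rewrite mulr_suml; apply: eq_bigr => m _; rewrite mulr_sumr.
  apply: eq_bigr => l _; rewrite rmorphM -!mulrA; congr (_ * _).
  by rewrite !mulrA algcC.
rewrite (@shiftE _ n n.+1) // exchange_big.
transitivity (\sum_(k < n.+1) \sum_(i < k.+1)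
    algc (zpow (i + (k - i))%N n : K) * (f i * g (k - i)%N)).
  apply: eq_bigr => k _; rewrite mulr_sumr.
  by apply: eq_bigr => i _; rewrite subnKC ?leq_ord.
rewrite (sum_triangle (fun i j => algc (zpow (i + j)%N n : K) * (f i * g j))).
apply: eq_bigr => m _; rewrite exchange_big /=.
rewrite [RHS](eq_bigr (fun l : 'I_n.+1 => algc (zpow (m + l)%N n : K) * (f m * g l))).
  rewrite (big_ord_widen n.+1 (fun l => algc (zpow (m + l)%N n : K) * (f m * g l))) ?leq_subr //.
  rewrite [RHS](bigID (fun l : 'I_n.+1 => (l < n.+1 - m)%N)) /=.
  rewrite [X in _ = _ + X]big1 ?addr0 // => l; rewrite -leqNgt leq_subLR => nl.
  by rewrite /= leqNgt nl rmorph0 mul0r.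
move=> l _; rewrite -mulr_suml -rmorph_sum; congr (algc _ * _).
by rewrite -zpowD fcoefM.
Qed.

Lemma fps_shiftB f g : fps_shift b (f - g) = fps_shift b f - fps_shift b g.
Proof.
apply: fpsP => n; rewrite fcoefB /= -sumrB.
by apply: eq_bigr => m _; rewrite -mulrBr.
Qed.

Lemma fps_shiftD f g : fps_shift b (f + g) = fps_shift b f + fps_shift b g.
Proof.
apply: fpsP => n; rewrite fcoefD /= -big_split.
by apply: eq_bigr => m _; exact: mulrDr.
Qed.

Lemma fps_shift_const (a : A) : fps_shift b (fconst a) = fconst a.
Proof.
apply: fpsP => n; rewrite /= big_ord_recl big1 ?addr0 => [|i _]; last by rewrite mulr0.
case: n => [|n] /=; first by rewrite bin0 expr0 mul1r rmorph1 mul1r.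
by rewrite subn0 bin_small // mul0r rmorph0 mul0r.
Qed.

Lemma fps_shift_zvar : fps_shift b (zvar A) = fscal A (zratio b) * zvar A.
Proof.
apply: fpsP => n; rewrite Mzvar /=.
case: n => [|n]; first by rewrite big_ord1 mulr0.
rewrite big_ord_recl mulr0 add0r big_ord_recl mulr1 big1 ?addr0 => [|i _]; last first.
  by rewrite mulr0.
by rewrite /= subSS subn0 binn mul1r.
Qed.

Lemma lead_shift m f a : lead m f a -> lead m (fps_shift b f) a.
Proof.
move=> [f0 fm]; split=> [k km|] /=.
  by rewrite big1 // => i _; rewrite f0 ?mulr0 // (leq_ltn_trans (leq_ord i)).
rewrite big_ord_recr /= subnn bin0 expr0 mul1r rmorph1 mul1r fm big1 ?add0r // => i _.
by rewrite f0 ?mulr0.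
Qed.

(** (z + b)^-m = z^-m - m b z^(-m-1) + ... *)
Lemma fcoef_shift_next m f : (forall k, (k < m)%N -> f k = 0) ->
  fps_shift b f m.+1 = f m.+1 - algc (m%:R * b) * f m.
Proof.
move=> f0; rewrite /= !big_ord_recr /= big1 => [|i _]; last by rewrite f0 ?mulr0.
rewrite add0r subnn bin0 expr0 mul1r rmorph1 mul1r subSnn bin1 expr1.
by rewrite mulrN rmorphN mulNr addrC.
Qed.

End Shift.

(** * Powers of z / (z + d) with exponent in an algebra *)

Section Theta.
Variable A : pzRingType.
Implicit Types f g : fps A.

(** The derivation - z d/dz, on series in z^-1. *)
Definition theta f : fps A := Fps (fun n => f n *+ n).

Lemma thetaM f g : theta (f * g) = theta f * g + f * theta g.
Proof.
apply: fpsP => n; rewrite fcoefD !fcoefM /= -sumrMnl -big_split.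
apply: eq_bigr => i _ /=; rewrite mulrnAl mulrnAr -mulrnDr subnKC //.
exact: leq_ord.
Qed.

Lemma thetaB f g : theta (f - g) = theta f - theta g.
Proof. by apply: fpsP => n; rewrite fcoefB /= mulrnBl. Qed.

Lemma theta1 : theta 1 = 0.
Proof. by apply: fpsP => -[|n] /=; rewrite ?mulr0n // mul0rn. Qed.

Lemma theta_fconst (a : A) : theta (fconst a) = 0.
Proof. by apply: fpsP => -[|n] /=; rewrite ?mulr0n // mul0rn. Qed.

Lemma thetaX f k : GRing.comm f (theta f) ->
  theta (f ^+ k.+1) = theta f * f ^+ k *+ k.+1.
Proof.
move=> cf; elim: k => [|k IH]; first by rewrite expr1 expr0 mulr1.
by rewrite exprS thetaM IH mulrnAr mulrA cf -mulrA -exprS -mulrS.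
Qed.

End Theta.

Section ExpLog.
Variables (K : numClosedFieldType) (A : pzAlgType K).
Implicit Types (f g : fps A) (c d : fps K^o).

Lemma algc_natr_mul (n : nat) (x : A) : algc (n%:R : K) * x = x *+ n.
Proof. by rewrite rmorph_nat mulr_natl. Qed.

Lemma algc_mul_eq0 (k : K) (x : A) : k != 0 -> algc k * x = 0 -> x = 0.
Proof.
move=> k0 kx; rewrite -[x]mul1r -(rmorph1 (@algc K A)) -(mulVf k0).
by rewrite rmorphM -mulrA kx mulr0.
Qed.

Lemma mulrn_alg_eq0 (n : nat) (x : A) : (0 < n)%N -> x *+ n = 0 -> x = 0.
Proof.
rewrite -algc_natr_mul => n0; apply: algc_mul_eq0.
by rewrite pnatr_eq0 -lt0n.
Qed.

Lemma theta_fscal c : theta (fscal A c) = fscal A (theta c).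
Proof. by apply: fpsP => n /=; rewrite rmorphMn. Qed.

(** Since M has no constant term, the coefficient of index m of the equation
    expresses m f_m through the previous coefficients. *)
Lemma theta_ode_uniq (M f g : fps A) : M 0%N = 0 -> f 0%N = g 0%N ->
  theta f = M * f -> theta g = M * g -> f = g.
Proof.
move=> M0 fg0 fM gM; apply/eqP; rewrite -subr_eq0; apply/eqP.
apply: lead_eq0 => m c [h0 hm].
have : theta (f - g) m = (M * (f - g)) m by rewrite thetaB fM gM mulrBr.
rewrite fcoefM big_ord_recl M0 mul0r add0r big1 => [|i _]; last first.
  by rewrite h0 ?mulr0 // ltn_subrL /= (leq_ltn_trans _ (ltn_ord i)).
rewrite -[LHS]/((f - g) m *+ m) hm; case: m h0 hm => [_ hm _|m _ _]; last exact: mulrn_alg_eq0.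
by rewrite -hm fcoefB fg0 subrr.
Qed.

(** Commutation of f with its derivative makes the derivative of f^k equal to
    k f^(k-1) f', as in a commutative algebra. *)
Lemma theta_exp f : f 0%N = 0 -> GRing.comm f (theta f) ->
  theta (fps_exp f) = theta f * fps_exp f.
Proof.
move=> f0 cf; apply: fpsP => n; rewrite fcoefM_rev /=.
rewrite big_ord_recl expr0 fcoef1 /= mulrnDl.
have -> : algc (0`!%:R^-1 : K) * (n == 0%N)%:R *+ n = 0 :> A.
  by case: n => [|n] //=; rewrite mulr0 mul0rn.
rewrite add0r.
transitivity (\sum_(k < n.+1) algc (k`!%:R^-1 : K) * (theta f * f ^+ k) n).
  have tail0 : (theta f * f ^+ n) n = 0.
    rewrite fcoefM big1 // => i _.
    have [->|i0] := eqVneq (i : nat) 0%N; first by rewrite /= mul0r.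
    rewrite fcoefX_small ?mulr0 // -subn_gt0 subKn ?leq_ord // lt0n.
    exact: i0.
  rewrite [RHS]big_ord_recr [X in _ = _ + algc _ * X]tail0 mulr0 addr0.
  rewrite -sumrMnl; apply: eq_bigr => k _ /=.
  rewrite -mulrnAr.
  have -> : (f ^+ k.+1) n *+ n = (theta f * f ^+ k) n *+ k.+1.
    by rewrite -[LHS]/(theta (f ^+ k.+1) n) thetaX // fcoefMn.
  rewrite -algc_natr_mul mulrA -rmorphM; congr (algc _ * _).
  by rewrite factS natrM invfM mulrAC mulVf ?mul1r // pnatr_eq0.
under [LHS]eq_bigr => k _ do rewrite fcoefM_rev mulr_sumr.
rewrite exchange_big /=; apply: eq_bigr => i _.
rewrite mulr_sumr.
rewrite -(big_mkord predT (fun k => algc (k`!%:R^-1 : K) * (theta f (n - i)%N * (f ^+ k) i))).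
rewrite (@big_cat_nat _ _ _ i.+1) //= [X in _ + X]big_nat_cond.
rewrite [X in _ + X]big1 ?addr0 => [|k /andP[/andP[ik _] _]]; last first.
  by rewrite fcoefX_small // !mulr0.
by rewrite big_mkord; apply: eq_bigr => k _; rewrite !mulrA algcC.
Qed.

Lemma fps_exp1 f : fps_exp f 1%N = f 1%N.
Proof.
rewrite /= big_ord_recr big_ord1 /= mulr0 add0r expr1.
by rewrite (_ : 1`!%:R^-1 = 1 :> K) ?rmorph1 ?mul1r //; exact: invr1.
Qed.

Lemma fps_log1 f : fps_log f 1%N = f 1%N.
Proof.
by rewrite /= big_nat1 expr0 divr1 rmorph1 mul1r expr1 fcoefB fcoef1 subr0.
Qed.

End ExpLog.

Section Power.
Variable K : numClosedFieldType.

(** The derivative of the logarithm series is a geometric series. *)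
Lemma theta_log (G : fps K^o) : G 0%N = 1 ->
  theta (fps_log G) = theta G * fps_inv G.
Proof.
move=> G0; apply: fpsP => n.
have thetaG0 : theta G 0%N = 0 by rewrite /= mulr0n.
transitivity ((theta G * \sum_(j < n) (1 - G) ^+ j) n); last first.
  rewrite !fcoefM !big_ord_recl thetaG0 !mul0r !add0r.
  apply: eq_bigr => i _; congr (_ * _); symmetry; apply: fps_invE => //.
  by rewrite ltn_subrL /= (leq_ltn_trans _ (ltn_ord i)).
have u0 : (G - 1) 0%N = 0 by rewrite fcoefB fcoef1 G0 subrr.
have thetaU : theta (G - 1) = theta G by rewrite thetaB theta1 subr0.
rewrite mulr_sumr fcoef_sum [LHS]/= big_add1 [n.+1.-1]/= big_mkord -sumrMnl.
apply: eq_bigr => j _; rewrite -mulrnAr.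
have -> : ((G - 1) ^+ j.+1) n *+ n = (theta G * (G - 1) ^+ j) n *+ j.+1.
  rewrite -[LHS]/(theta ((G - 1) ^+ j.+1) n) thetaX ?thetaU ?fcoefMn //.
  exact: fps_mulC.
rewrite -(@algc_natr_mul K K^o j.+1 ((theta G * _) n)) mulrA -rmorphM divfK ?pnatr_eq0 //.
have -> : theta G * (1 - G) ^+ j = algc ((-1) ^+ j : K) * (theta G * (G - 1) ^+ j).
  by rewrite -[1 - G]opprB [in LHS]exprNn mulrA [RHS]mulrA algcC rmorphXn rmorphN rmorph1.
by rewrite fcoef_algcM.
Qed.

(** The conjugation properties of H = G^a, for G = z / (z + d), come from the
    equation theta H = ell a H with ell = theta (log G): each of them is an
    equality between two solutions of one equation.  This avoids the addition
    formula for the exponential and the identity exp (log G) = G. *)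
Variables (A : pzAlgType K) (d : K) (a : A).
Let kapd : fps K^o := 1 + algc d * zvar K^o.
Let ell : fps K^o := theta (fps_log (zratio d)).
Let H : fps A := fps_pow (zratio d) a.

Let kapd_ell : kapd * ell = - theta kapd.
Proof.
have G0 : zratio d 0%N = 1 by rewrite /= expr0.
have kG : kapd * zratio d = 1 by exact: zratioV.
have invG : fps_inv (zratio d) = kapd.
  by rewrite -[LHS]mul1r -kG -mulrA fps_mulV // mulr1.
have := thetaM kapd (zratio d); rewrite kG theta1 => /esym/eqP; rewrite addrC addr_eq0 => /eqP tk.
by rewrite /ell theta_log // invG mulrA tk mulNr -mulrA [zratio d * _]fps_mulC kG mulr1.
Qed.

Let H0 : H 0%N = 1.
Proof. by rewrite /= big_ord1 expr0 fact0 invr1 rmorph1 mulr1. Qed.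

Let expoE : Fps (fun n => algc (fps_log (zratio d) n : K) * a) =
  fscal A (fps_log (zratio d)) * fconst a.
Proof. by apply: fpsP => n; rewrite Mfconst. Qed.

Let theta_expo : theta (fscal A (fps_log (zratio d)) * fconst a) = fscal A ell * fconst a.
Proof. by rewrite thetaM theta_fconst mulr0 addr0 theta_fscal. Qed.

Let thetaH : theta H = fscal A ell * fconst a * H.
Proof.
rewrite /H /fps_pow expoE theta_exp ?theta_expo //.
  by rewrite fcoef0M /= big_geq // rmorph0 mul0r.
rewrite /GRing.comm -!mulrA [fconst a * (_ * _)]mulrA [fconst a * (_ * _)]mulrA.
by rewrite -!fscalC -!mulrA mulrA -fscalM [fps_log _ * _]fps_mulC fscalM -mulrA.
Qed.

Let ell0 : (fscal A ell * fconst a) 0%N = 0.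
Proof. by rewrite fcoef0M /= mulr0n rmorph0 mul0r. Qed.

Let kapd_ellA : fscal A kapd * fscal A ell = - fscal A (theta kapd).
Proof. by rewrite -fscalM kapd_ell fscalN. Qed.

Let kap0 : fscal A kapd 0%N = 1.
Proof. by rewrite -[LHS]/(algc (kapd 0%N : K)) fcoefD fcoef1 fcoef_algcM mulr0 addr0 rmorph1. Qed.

Lemma fps_pow_coef0 : H 0%N = 1. Proof. exact: H0. Qed.

Lemma fps_pow_coef1 : H 1%N = - (algc d * a).
Proof.
have -> : H 1%N = algc (fps_log (zratio d) 1%N : K) * a by exact: fps_exp1.
rewrite fps_log1 (_ : zratio d 1%N = - d); last exact: expr1.
by rewrite rmorphN mulNr.
Qed.

Lemma fps_pow_comm (x : A) : a * x = x * a -> H * fconst x = fconst x * H.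
Proof.
move=> ax.
have fax : fconst a * fconst x = fconst x * fconst a.
  by apply: fpsP => n; rewrite !fconstM /=; case: eqP => //; rewrite !mulr0.
apply: (@theta_ode_uniq _ _ (fscal A ell * fconst a)).
- exact: ell0.
- by rewrite !fcoef0M H0 mulr1 mul1r.
- by rewrite thetaM thetaH theta_fconst mulr0 addr0 mulrA.
- rewrite thetaM thetaH theta_fconst mul0r add0r !mulrA -fscalC.
  by rewrite -[fscal A ell * fconst x * _]mulrA -fax !mulrA.
Qed.

(** G^a x = x G^(a-1) when a x = x (a - 1), and G^-1 = 1 + d / z. *)
Lemma fps_pow_lower (x : A) : a * x = x * a - x ->
  H * fconst x = fscal A kapd * (fconst x * H).
Proof.
move=> ax.
have fax : fconst x * fconst a = fconst a * fconst x + fconst x.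
  apply: fpsP => n; rewrite fcoefD !fconstM /=.
  by case: eqP => _; rewrite ?mulr0 ?addr0 // ax subrK.
apply: (@theta_ode_uniq _ _ (fscal A ell * fconst a)).
- exact: ell0.
- by rewrite !fcoef0M kap0 H0 mulr1 !mul1r.
- by rewrite thetaM thetaH theta_fconst mulr0 addr0 mulrA.
- rewrite !thetaM thetaH theta_fconst mul0r add0r theta_fscal.
  rewrite -[fscal A ell * _ * H]mulrA fscalCA [fconst x * (_ * H)]mulrA fax.
  rewrite mulrDl !mulrDr [X in _ + (_ + X)]mulrA kapd_ellA mulNr addrC subrK.
  by rewrite -[RHS]mulrA [fconst a * (fscal A kapd * _)]fscalCA [RHS]fscalCA [fconst a * (_ * H)]mulrA.
Qed.

(** Here x G^a = G^(a-1) x, as a x = x (a + 1). *)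
Lemma fps_pow_raise (x : A) : a * x = x * a + x ->
  H * (fscal A kapd * fconst x) = fconst x * H.
Proof.
move=> ax.
have fax : fconst x * fconst a = fconst a * fconst x - fconst x.
  apply: fpsP => n; rewrite fcoefB !fconstM /=.
  by case: eqP => _; rewrite ?mulr0 ?subr0 // ax addrK.
apply: (@theta_ode_uniq _ _ (fscal A ell * (fconst a - 1))).
- by rewrite fcoef0M /= mulr0n rmorph0 mul0r.
- by rewrite !fcoef0M kap0 H0 mulr1 !mul1r.
- rewrite !thetaM thetaH theta_fconst mulr0 addr0 theta_fscal.
  rewrite [H * (fscal A kapd * _)]fscalCA [H * (fscal A (theta kapd) * _)]fscalCA.
  rewrite mulrBr mulr1 mulrBl [fscal A ell * _ * (_ * _)]fscalCA.
  rewrite [fscal A ell * (_ * _)]mulrA [fscal A ell * fscal A kapd]fscalC kapd_ellA.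
  rewrite mulNr opprK -!mulrA [H * (fscal A kapd * _)]fscalCA.
  by rewrite [fconst a * (fscal A kapd * _)]fscalCA [fscal A ell * (fscal A kapd * _)]fscalCA.
- rewrite thetaM thetaH theta_fconst mul0r add0r -[fscal A ell * _ * H]mulrA fscalCA.
  rewrite [fconst x * _]mulrA fax -[RHS]mulrA; congr (_ * _).
  by rewrite !mulrBl mul1r mulrA.
Qed.

End Power.

(** * Conjugation relations and their defects *)

Section Linear.
Variables (K : numClosedFieldType) (A : pzAlgType K).
Implicit Types (u v w : K * K) (X Y : nat -> fps A) (f g : fps A).

(** With sigma the shift X n |-> X (n + 1), this is the operator
    1 + (a + c sigma) / z for u = (a, c). *)
Definition lin u X : nat -> fps A :=
  fun n => X n + zvar A * (algc u.1 * X n + algc u.2 * X n.+1).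

Lemma linD u X Y : lin u (fun n => X n + Y n) = fun n => lin u X n + lin u Y n.
Proof.
apply/funext => n; rewrite /lin [RHS]addrACA -[in RHS]mulrDr.
by rewrite [in RHS]addrACA -!mulrDr.
Qed.

Lemma linN u X : lin u (fun n => - X n) = fun n => - lin u X n.
Proof. by apply/funext => n; rewrite /lin !mulrN -opprD mulrN -opprD. Qed.

Lemma linB u X Y : lin u (fun n => X n - Y n) = fun n => lin u X n - lin u Y n.
Proof. by rewrite linD linN. Qed.

Lemma linMl u g X : lin u (fun n => g * X n) = fun n => g * lin u X n.
Proof.
apply/funext => n; rewrite /lin [RHS]mulrDr [g * (zvar A * _)]mulrA -zvarC.
by rewrite -[zvar A * g * _]mulrA [g * (_ + _)]mulrDr !(mulrA g) -!algcC -!mulrA.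
Qed.

Lemma linMr u g X : lin u (fun n => X n * g) = fun n => lin u X n * g.
Proof. by apply/funext => n; rewrite /lin !(mulrDl, mulrDr) !mulrA. Qed.

(** Both operators are polynomials in sigma with central coefficients. *)
Lemma linC u v X : lin u (lin v X) = lin v (lin u X).
Proof.
rewrite -[lin v X]/(fun n => X n + zvar A * (algc v.1 * X n + algc v.2 * X n.+1)).
by rewrite linD linMl linD !linMl.
Qed.

Lemma lin0 X : lin (0, 0) X = X.
Proof. by apply/funext => n; rewrite /lin rmorph0 !mul0r addr0 mulr0 addr0. Qed.

Lemma lin_scal b X : lin (b, 0) X = fun n => (1 + algc b * zvar A) * X n.
Proof.
apply/funext => n; rewrite /lin rmorph0 mul0r addr0 mulrDl mul1r.
by rewrite mulrA zvarC.
Qed.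

Lemma lin_coefS u X n k :
  lin u X n k.+1 = X n k.+1 + (algc u.1 * X n k + algc u.2 * X n.+1 k).
Proof. by rewrite /lin fcoefD zvarM fcoefD !fcoef_algcM. Qed.

Lemma lin_coef0 u X n : lin u X n 0%N = X n 0%N.
Proof. by rewrite /lin fcoefD zvarM addr0. Qed.

(** As lin u is 1 + O(z^-1), it neither changes first coefficients nor kills
    anything; this is what allows cancellation of common factors of fractions. *)
Lemma lead_lin m u X (d : nat -> A) :
  (forall n, lead m (X n) (d n)) -> forall n, lead m (lin u X n) (d n).
Proof.
move=> Xd n; have Z k i : (k < m)%N -> X i k = 0 by case: (Xd i) => + _; exact.
have [_ Xm] := Xd n; split=> [[|k] km|]; first by rewrite lin_coef0 Z.
  by have km' := ltnW km; rewrite lin_coefS !Z // !mulr0 !addr0.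
case: m Xd Z Xm => [|m] Xd Z Xm; first by rewrite lin_coef0.
by rewrite lin_coefS !(Z m) // Xm !mulr0 !addr0.
Qed.

Lemma lin_lead m u X (d : nat -> A) :
  (forall n, lead m (lin u X n) (d n)) -> forall n, lead m (X n) (d n).
Proof.
move=> Xd.
have X0 k : (k < m)%N -> forall n, X n k = 0.
  elim: k => [|k IH] km n; have [+ _] := Xd n; move/(_ _ km).
    by rewrite lin_coef0.
  by have km' := ltnW km; rewrite lin_coefS !IH // !mulr0 !addr0.
move=> n; split=> [k km|]; first exact: X0.
have [_ <-] := Xd n; case: m Xd X0 => [|m] _ X0; first by rewrite lin_coef0.
by rewrite lin_coefS !(X0 m) // !mulr0 !addr0.
Qed.

Lemma lin_eq0 u X : lin u X = (fun=> 0) -> X = (fun=> 0).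
Proof.
move=> uX; apply/funext => n; apply: fpsP => m.
have uX0 k : lead m (lin u X k) 0 by rewrite uX.
by have [_ ->] := lin_lead uX0 n.
Qed.

Lemma lin_inj u : injective (lin u).
Proof.
move=> X Y uXY; apply/funext => n; apply/eqP; rewrite -subr_eq0; apply/eqP.
suff : (fun n => X n - Y n) = (fun=> 0) by move/(congr1 (fun F => F n)).
by apply: (@lin_eq0 u); rewrite linB uXY; apply/funext => k; rewrite subrr.
Qed.

(** The translation by b turns (z + a + c sigma) / z into
    (z + b + a + c sigma) / (z + b); the denominator z is restored by the factor
    1 + b / z. *)
Lemma lin_shift b u X :
  lin (u.1 + b, u.2) (fun n => fps_shift b (X n)) =
  fun n => (1 + algc b * zvar A) * fps_shift b (lin u X n).
Proof.
have kr : (1 + algc b * zvar A) * fscal A (zratio b) = 1.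
  by rewrite -[RHS](fscal1 A) -(zratioV b) fscalM fscalD fscal1 fscalM fscal_algc fscal_zvar.
have shiftZ k : fps_shift b (algc k : fps A) = algc k by exact: fps_shift_const.
apply/funext => n; rewrite /lin fps_shiftD fps_shiftM fps_shift_zvar [RHS]mulrDr.
rewrite [_ * (fscal A _ * _ * _)]mulrA [_ * (fscal A _ * _)]mulrA kr mul1r.
rewrite fps_shiftD !fps_shiftM !shiftZ [(1 + _) * _]mulrDl mul1r -[RHS]addrA.
congr (_ + _); rewrite rmorphD [(_ + algc b) * _]mulrDl [algc u.1 * _ + _]addrC -addrA mulrDr.
by rewrite [zvar A * (algc b * _)]mulrA zvarC.
Qed.

End Linear.

Section Defect.
Variables (K : numClosedFieldType) (A : pzAlgType K) (x : nat -> A).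
Implicit Types (u v w : K * K) (f g : fps A) (d : nat -> A).

Let xc : nat -> fps A := fun n => fconst (x n).

(** When this vanishes, g x g^-1 is the image of x under the fraction v / u of
    operators; keeping u and v apart avoids inverting operators. *)
Definition defect g u v : nat -> fps A :=
  fun n => g * lin u xc n - lin v xc n * g.

Lemma lin_defect g u v w :
  lin w (defect g u v) = fun n => g * lin w (lin u xc) n - lin w (lin v xc) n * g.
Proof. by rewrite /defect linB linMl linMr. Qed.

(** Defects add up along a composition of conjugations, after multiplication
    by the intermediate operator. *)
Lemma defect_comp g1 g2 u v w :
  lin v (defect (g1 * g2) u w) =
  fun n => g1 * lin u (defect g2 v w) n + lin w (defect g1 u v) n * g2.
Proof.
rewrite !lin_defect; apply/funext => n.
rewrite mulrBr mulrBl !mulrA [lin u (lin v xc)]linC [lin u (lin w xc)]linC.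
by rewrite [lin v (lin w xc)]linC addrA subrK.
Qed.

Lemma defect_comp_rev g1 g2 u v w :
  lin v (defect (g2 * g1) u w) =
  fun n => g2 * lin v (defect g1 u v) n + lin v (defect g2 v w) n * g1.
Proof.
by rewrite !lin_defect; apply/funext => n; rewrite mulrBr mulrBl !mulrA addrA subrK.
Qed.

Lemma defect_inv g u v : g 0%N = 1 ->
  defect (fps_inv g) v u = fun n => - (fps_inv g * defect g u v n * fps_inv g).
Proof.
move=> g0; apply/funext => n; rewrite /defect mulrBr mulrBl opprB.
rewrite -!mulrA [g * (lin u xc n * _)]mulrA.
by rewrite [fps_inv g * (g * _ * _)]mulrA [fps_inv g * (g * _)]mulrA fps_Vmul // mul1r fps_mulV // mulr1.
Qed.

Lemma defect_shift b g u v :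
  defect (fps_shift b g) (u.1 + b, u.2) (v.1 + b, v.2) =
  fun n => (1 + algc b * zvar A) * fps_shift b (defect g u v n).
Proof.
have xcS : xc = fun n => fps_shift b (xc n).
  by apply/funext => n; rewrite /xc fps_shift_const.
apply/funext => n; rewrite /defect xcS !lin_shift -xcS fps_shiftB !fps_shiftM.
rewrite mulrBr !mulrA; congr (_ * _ - _).
rewrite mulrDr mulrDl mulr1 mul1r; congr (_ + _).
by rewrite mulrA -algcC -mulrA -zvarC mulrA.
Qed.

(** The lowest coefficients of defects behave additively: they add up under
    products of series, are negated by inversion, and are kept by translation of
    the variable. *)
Definition ldefect m g u v d := forall n, lead m (defect g u v n) (d n).

Lemma ldefect_comp m g1 g2 u v w d1 d2 : g1 0%N = 1 -> g2 0%N = 1 ->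
  ldefect m g1 u v d1 -> ldefect m g2 v w d2 ->
  ldefect m (g1 * g2) u w (fun n => d2 n + d1 n).
Proof.
move=> g10 g20 h1 h2; apply: (@lin_lead _ _ _ v) => n; rewrite defect_comp.
by apply: leadD; [apply: leadMl => //|apply: leadMr => //]; exact: lead_lin.
Qed.

Lemma ldefect_comp_rev m g1 g2 u v w d1 d2 : g1 0%N = 1 -> g2 0%N = 1 ->
  ldefect m g1 u v d1 -> ldefect m g2 v w d2 ->
  ldefect m (g2 * g1) u w (fun n => d1 n + d2 n).
Proof.
move=> g10 g20 h1 h2; apply: (@lin_lead _ _ _ v) => n; rewrite defect_comp_rev.
by apply: leadD; [apply: leadMl => //|apply: leadMr => //]; exact: lead_lin.
Qed.

Lemma ldefect_inv m g u v d : g 0%N = 1 ->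
  ldefect m g u v d -> ldefect m (fps_inv g) v u (fun n => - d n).
Proof.
move=> g0 h n; rewrite defect_inv //; apply: leadN.
by apply: leadMr; [exact: fps_inv0|apply: leadMl; [exact: fps_inv0|exact: h]].
Qed.

Lemma ldefect_shift m b g u v d :
  ldefect m g u v d -> ldefect m (fps_shift b g) (u.1 + b, u.2) (v.1 + b, v.2) d.
Proof.
move=> h n; rewrite defect_shift; apply: leadMl; last exact/lead_shift/h.
by rewrite fcoefD fcoef_algcM mulr0 addr0.
Qed.

(** For u = v the defect is lin u applied to a commutator. *)
Lemma ldefect_diag m g u v d : ldefect m g u u d -> ldefect m g v v d.
Proof.
have defectE w : defect g w w = lin w (defect g (0, 0) (0, 0)).
  by rewrite lin_defect lin0.
rewrite /ldefect !(defectE u) !(defectE v) => h.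
exact/lead_lin/(lin_lead h).
Qed.

(** The sequences x^+ ([s = true]) and x^- ([s = false]) are conjugated by
    inverse fractions, hence the exchange of u and v. *)
Definition sdefect (s : bool) m g u v d :=
  if s then ldefect m g u v d else ldefect m g v u d.

Lemma sdefect_comp s m g1 g2 u v w d1 d2 : g1 0%N = 1 -> g2 0%N = 1 ->
  sdefect s m g1 u v d1 -> sdefect s m g2 v w d2 ->
  sdefect s m (g1 * g2) u w (fun n => d1 n + d2 n).
Proof.
rewrite (_ : (fun n => _) = fun n => d2 n + d1 n); last by apply/funext => n; rewrite addrC.
move=> g10 g20; case: s => /= h1 h2; first exact: (ldefect_comp g10 g20 h1 h2).
exact: (ldefect_comp_rev g20 g10 h2 h1).
Qed.

Lemma sdefect_inv s m g u v d : g 0%N = 1 ->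
  sdefect s m g u v d -> sdefect s m (fps_inv g) v u (fun n => - d n).
Proof. by case: s => g0 /= h; exact: ldefect_inv. Qed.

Lemma sdefect_shift s m b g u v d : sdefect s m g u v d ->
  sdefect s m (fps_shift b g) (u.1 + b, u.2) (v.1 + b, v.2) d.
Proof. by case: s => /= h; exact: ldefect_shift h. Qed.

Lemma sdefect_diag s m g u v d : sdefect s m g u u d -> sdefect s m g v v d.
Proof. by case: s => /= h; exact: ldefect_diag h. Qed.

Lemma sdefect_uniq s m g u v d d' :
  sdefect s m g u v d -> sdefect s m g u v d' -> d =1 d'.
Proof. by case: s => /= h h' n; exact: lead_uniq (h n) (h' n). Qed.

End Defect.

(** If y z^-m is the first term of e n, then the coefficients of index m + 1 give
    m b y = 0: the translation contributes - m b y, the factor B = 1 + O(z^-2)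
    nothing, and the operators the same amount on both sides. *)
Lemma shift_fix_eq0 (K : numClosedFieldType) (A : pzAlgType K) (b c : K)
    (e : nat -> fps A) (B : fps A) :
  b != 0 -> B 0%N = 1 -> B 1%N = 0 -> (forall n, e n 0%N = 0) ->
  lin (0, c) (lin (b, 0) (fun n => fps_shift b (e n))) = lin (b, c) (fun n => e n * B) ->
  e = fun=> 0.
Proof.
move=> b0 B0 B1 e0 eB; suff em m : forall n, e n m = 0.
  by apply/funext => n; apply: fpsP => m; exact: em.
elim/ltn_ind: m => m IH n; case: m IH => [//|m] IH.
have sh k i : (k <= m.+1)%N -> fps_shift b (e i) k = e i k.
  move=> km; have : lead k (e i) (e i k) by split=> // j jk; rewrite IH // (leq_trans jk).
  by case/(lead_shift b).
have eBlow k i : (k <= m.+1)%N -> (e i * B) k = e i k.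
  move=> km; have : lead k (e i) (e i k) by split=> // j jk; rewrite IH // (leq_trans jk).
  by case/(leadMr B0).
have eBtop i : (e i * B) m.+2 = e i m.+2.
  rewrite fcoefM big_ord_recr big_ord_recr /= subnn subSnn B0 B1 mulr1 mulr0 addr0 big1 ?add0r // => j _.
  by rewrite IH ?mul0r.
have := congr1 (fun F : nat -> fps A => F n m.+2) eB; rewrite !lin_coefS !rmorph0 !mul0r !add0r !addr0.
rewrite fcoef_shift_next; last by move=> k km; exact: IH.
rewrite eBtop !eBlow // !sh //=.
rewrite (IH m) // mulr0 addr0 -!addrA => /addrI /eqP.
rewrite -subr_eq0 addrK oppr_eq0 => /eqP; apply: algc_mul_eq0.
by rewrite mulf_neq0 // pnatr_eq0.
Qed.

(** * The GKLO series *)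

(** A vector killed by the Cartan matrix is isotropic for the positive definite
    form d_i c_ij. *)
Lemma cartan_det_neq0 r (g : simple_datum r) : \det (cartan g) != 0.
Proof.
rewrite -det_tr; apply/negP => /det0P[v v0 vC].
have := cartan_posdef g v0.
rewrite big1 ?ltxx // => i _.
have : (v *m (cartan g)^T) 0 i = 0 by rewrite vC mxE.
rewrite mxE => vi.
rewrite (eq_bigr (fun j => v 0 i * (symd g i)%:Z * (v 0 j * (cartan g)^T j i))).
  by rewrite -mulr_sumr vi mulr0.
by move=> j _; rewrite !mxE mulrACA mulrA mulrAC -!mulrA; congr (_ * _); rewrite mulrCA.
Qed.

Section DefectCoef.
Variables (K : numClosedFieldType) (A : pzAlgType K) (x : nat -> A).

Lemma defect_coef0 (g : fps A) u v n :
  defect x g u v n 0%N = g 0%N * x n - x n * g 0%N.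
Proof. by rewrite /defect fcoefB !fcoef0M !lin_coef0. Qed.

Lemma defect_coefS (g : fps A) (a b c e : K) n k :
  defect x g (a, c) (b, e) n k.+1 =
    (g k.+1 * x n + g k * (algc a * x n + algc c * x n.+1))
    - (x n * g k.+1 + (algc b * x n + algc e * x n.+1) * g k).
Proof.
have cM q y : algc q * fconst y = fconst (algc q * y) :> fps A.
  by apply: fpsP => -[|k']; rewrite fcoef_algcM //= mulr0.
rewrite /defect fcoefB /lin mulrDr mulrDl !fcoefD Mfconst fconstM !cM.
by rewrite mulrA -zvarC -!mulrA !zvarM mulrDr mulrDl !fcoefD !Mfconst !fconstM mulrDr mulrDl.
Qed.

End DefectCoef.

Section Yangian.
Variables (K : numClosedFieldType) (r : nat) (g : simple_datum r) (mu : 'rV[int]_r).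
Local Notation Y := (Yangian K g mu).
Local Notation xi := (yxi K g mu).
Local Notation xs := (yx K g mu).
Local Notation d := (dnode K g).
Local Notation dp := (dpair K g).
Local Notation sg s := (if s then 1 else -1 : K).

Let yclass (a : term K (ygen r)) : Y := pclass (@yrel K r g mu) a.

Let yclassB a b : yclass (tsub a b) = yclass a - yclass b.
Proof.
rewrite /yclass /tsub /tscale pclass_add pclass_mul pclass_scal.
by rewrite rmorphN rmorph1 mulN1r.
Qed.

Lemma yxi_comm i p j q : xi i p * xi j q = xi j q * xi i p.
Proof.
have := pclass_rel (yrel_xixi K g mu i p j q).
rewrite -/(yclass _) /tcomm yclassB /yclass !pclass_mul pclass_scal rmorph0.
by move/eqP; rewrite subr_eq0 => /eqP.
Qed.

Lemma yxi_x s i p j n :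
  (xi i (p + 1) * xs s j n - xs s j n * xi i (p + 1)) -
  (xi i p * xs s j n.+1 - xs s j n.+1 * xi i p) =
  algc (sg s * dp i j) * (xi i p * xs s j n + xs s j n * xi i p).
Proof.
have := pclass_rel (yrel_xix K g mu s i p j n).
rewrite -/(yclass _) /tcomm !yclassB /yclass /tscale /tanti.
by rewrite !(pclass_mul, pclass_add) pclass_scal.
Qed.

Lemma xibar0 i : xibar K g mu i 0%N = 1.
Proof.
rewrite /= sub0r -opprD addrC opprD.
have := pclass_rel (yrel_lead K g mu i).
by rewrite pclass_scal rmorph1.
Qed.

Lemma Yzero_comm x y : @Yzero K r g mu x -> @Yzero K r g mu y -> x * y = y * x.
Proof.
move=> hx hy; elim: hx => [i p|k|x1 x2 _ IH1 _ IH2|x1 x2 _ IH1 _ IH2].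
- elim: hy => [j q|k|y1 y2 _ IH1 _ IH2|y1 y2 _ IH1 _ IH2].
  + exact: yxi_comm.
  + by rewrite algcC.
  + by rewrite mulrDl mulrDr IH1 IH2.
  + by rewrite mulrA IH1 -mulrA IH2 mulrA.
- by rewrite algcC.
- by rewrite mulrDl mulrDr IH1 IH2.
- by rewrite -mulrA IH2 mulrA IH1 mulrA.
Qed.

(** With generating series, the relation between xi_i and x^+_j reads
    xi_i(z) (z - sigma - d_ij) x^+_j = (z - sigma + d_ij) x^+_j xi_i(z); the sign of
    d_ij changes for x^-_j. *)
Lemma xibar_defect s m i j :
  sdefect (xs s j) s m (xibar K g mu i) (- dp i j, -1) (dp i j, -1) (fun=> 0).
Proof.
suff D0 n k : defect (xs s j) (xibar K g mu i) (- (sg s * dp i j), -1) (sg s * dp i j, -1) n k = 0.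
  case: s D0 => D0 n; split=> [k _|].
  - by have := D0 n k; rewrite mul1r.
  - by have := D0 n m; rewrite mul1r.
  - by have := D0 n k; rewrite mulN1r opprK.
  - by have := D0 n m; rewrite mulN1r opprK.
case: k => [|k]; first by rewrite defect_coef0 xibar0 mul1r mulr1 subrr.
have := yxi_x s i (k%:Z - 1 - pairing mu (alpha i)) j n.
have -> : k%:Z - 1 - pairing mu (alpha i) + 1 = k.+1%:Z - 1 - pairing mu (alpha i).
  by rewrite addrAC subrK intS [1 + _]addrC addrK.
rewrite defect_coefS.
rewrite -[xi i (k%:Z - _ - _)]/(xibar K g mu i k) -[xi i (k.+1%:Z - _ - _)]/(xibar K g mu i k.+1).
move: (xibar K g mu i k) (xibar K g mu i k.+1) => a b.
set e := sg s * _; move: (xs s j n) (xs s j n.+1) => y y' /eqP.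
rewrite -subr_eq0 => /eqP E; rewrite -[RHS]E.
rewrite rmorphN rmorphN1 !mulN1r !mulNr !(mulrDl, mulrDr) !mulNr !mulrN.
rewrite !mulrA -(algcC e a) !opprD !opprK.
by rewrite /= !addrA [LHS](ACl (1*4*3*6*2*5))%AC.
Qed.

(** Multiplication by the adjugate of the Cartan matrix gives det f_l = 0 in an
    algebra of characteristic zero. *)
Lemma sum_cartan_eq0 (f : 'I_r -> Y) :
  (forall i, \sum_j f j *~ cartan g j i = 0) -> forall l, f l = 0.
Proof.
move=> fC l; have : f l *~ \det (cartan g) = 0.
  transitivity (\sum_i (\sum_j f j *~ cartan g j i) *~ (\adj (cartan g)) i l).
    under eq_bigr => i _ do rewrite mulrz_suml.
    rewrite exchange_big /=.
    rewrite (eq_bigr (fun j => f j *~ (cartan g *m \adj (cartan g)) j l)) => [|j _].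
      rewrite mul_mx_adj (bigD1 l) //= mxE eqxx big1 ?addr0 // => j jl.
      by rewrite mxE (negPf jl).
    by rewrite mxE mulrz_sumr; apply: eq_bigr => i _; rewrite mulrzA.
  by rewrite big1 // => i _; rewrite fC mul0rz.
rewrite -mulrzl -(rmorph_int (@algc K Y)); apply: algc_mul_eq0.
by rewrite intr_eq0 cartan_det_neq0.
Qed.

Lemma dpair_diag i : dp i i = d i.
Proof. by rewrite /dpair cartan_diag intrM mulfK // pnatr_eq0. Qed.

Lemma dpair_double i j : dp i j + dp i j = d j * (cartan g j i)%:~R.
Proof.
by rewrite /dpair cartan_sym intrM -mulr2n -[LHS]mulr_natr divfK // pnatr_eq0.
Qed.

Lemma fps_prod_coef0 (I : Type) (l : seq I) (P : pred I) (F : I -> fps Y) :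
  (forall j, P j -> F j 0%N = 1) -> (\prod_(j <- l | P j) F j) 0%N = 1.
Proof.
move=> F0; apply: (big_ind (fun f : fps Y => f 0%N = 1)) => // f1 f2 f10 f20.
by rewrite fcoef0M f10 f20 mulr1.
Qed.

Section Product.
Variables (x : nat -> Y) (s : bool) (m : nat).
Local Notation sdef := (sdefect x s m).

(** At most the factor of index k conjugates x, the others commute with it; the
    leading defects of all of them add up. *)
Lemma sdefect_prod (I : eqType) (l : seq I) (P : pred I) (F : I -> fps Y)
    (f : I -> nat -> Y) (k : I) (u v : K * K) : uniq l ->
  (forall j, P j -> F j 0%N = 1) ->
  (forall j, P j -> j != k -> sdef (F j) v v (f j)) ->
  (P k -> sdef (F k) u v (f k)) ->
  sdef (\prod_(j <- l | P j) F j) (if (k \in l) && P k then u else v) v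
    (fun n => \sum_(j <- l | P j) f j n).
Proof.
move=> + F0 Fv Fk; elim: l => [_|j l IH /= /andP[jl ul]].
  rewrite /= big_nil; have D0 n : defect x 1 v v n = 0 by rewrite /defect mul1r mulr1 subrr.
  by case: (s) => n /=; rewrite D0 big_nil.
rewrite big_cons inE.
have -> : (fun n => \sum_(i <- j :: l | P i) f i n) =
    fun n => if P j then f j n + \sum_(i <- l | P i) f i n else \sum_(i <- l | P i) f i n.
  by apply/funext => n; rewrite big_cons.
case: ifP => Pj; last first.
  rewrite (_ : _ && P k = (k \in l) && P k); first exact: IH.
  by case: eqP => // ->; rewrite Pj !andbF.
have G0 := fps_prod_coef0 l F0.
have [kj|kj] := eqVneq k j.
  rewrite /= kj Pj; move: (IH ul); rewrite kj (negPf jl) /= => IHv.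
  by apply: sdefect_comp IHv; rewrite ?F0 // -kj; apply: Fk; rewrite kj.
rewrite /=; apply: sdefect_comp (IH ul); rewrite ?F0 //.
by apply: sdefect_diag; apply: Fv; rewrite // eq_sym.
Qed.

End Product.
End Yangian.

Section GKLO.
Variables (K : numClosedFieldType) (r : nat) (g : simple_datum r) (mu : 'rV[int]_r).
Local Notation Y := (Yangian K g mu).
Local Notation xs := (yx K g mu).
Local Notation d := (dnode K g).
Local Notation dp := (dpair K g).

Variable A : 'I_r -> fps Y.
Hypothesis hA : is_GKLO A.

Let A0 i : A i 0%N = 1. Proof. by have [h _] := hA; case: (h i). Qed.

Let shA0 b i : fps_shift b (A i) 0%N = 1.
Proof. by rewrite /= big_ord1 bin0 expr0 mulr1 rmorph1 mul1r A0. Qed.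

Section Node.
Variables (s : bool) (k : 'I_r) (m : nat) (f : 'I_r -> nat -> Y).
Local Notation sdef := (sdefect (xs s k) s m).

Hypothesis Af : forall j, sdef (A j) (if j == k then d k else 0, -1) (0, -1) (f j).

Let Af_diag b j v : j != k -> sdef (fps_shift b (A j)) v v (f j).
Proof.
move=> jk; have := Af j; rewrite (negPf jk) => /(sdefect_shift b).
exact: sdefect_diag.
Qed.

(** For j = k, the numerator of the fraction of each factor is the denominator of
    the next one. *)
Let shifts_defect c j T :
  sdef (\prod_(1 <= t < T.+1) fps_shift (c - t%:R * d j) (A j))
    (c, -1) (c - T%:R * (if j == k then d k else 0), -1) (fun n => f j n *+ T).
Proof.
elim: T => [|T IH].
  rewrite big_geq // mul0r subr0; apply: (@sdefect_diag _ _ _ _ _ _ (0, 0)).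
  by case: (s) => n /=; rewrite /defect mul1r mulr1 subrr.
rewrite big_nat_recr //=.
rewrite (_ : (fun n => _) = fun n => f j n *+ T + f j n); last first.
  by apply/funext => n; rewrite mulrSr.
apply: sdefect_comp IH _ => //.
  by apply: fps_prod_coef0 => t _; exact: shA0.
case: eqP => [jk|/eqP jk]; last by rewrite !mulr0; exact: Af_diag.
have := sdefect_shift (c - T.+1%:R * d j) (Af j).
rewrite jk eqxx /= add0r.
by have -> : d k + (c - T.+1%:R * d k) = c - T%:R * d k by rewrite -natr1; ring.
Qed.

(** Over t, the fraction of the factor j = k telescopes from z - sigma - d_ik to
   z - sigma + d_ik, because d_k c_ki = 2 d_ik.  If c_ki = 0 there is no such
   factor, and d_ik = 0. *)
Let shifts_prod_defect i :
  sdef (\prod_(j < r | cartan g j i < 0) \prod_(1 <= t < `|cartan g j i|%N.+1)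
          fps_shift (- dp i j - t%:R * d j) (A j))
    (if k == i then (d k, -1) else (- dp i k, -1))
    (if k == i then (d k, -1) else (dp i k, -1))
    (fun n => \sum_(j < r | cartan g j i < 0) f j n *+ `|cartan g j i|%N).
Proof.
set v : K * K := if k == i then (d k, -1) else (dp i k, -1).
have T0 j : (\prod_(1 <= t < `|cartan g j i|%N.+1)
    fps_shift (- dp i j - t%:R * d j) (A j)) 0%N = 1.
  by apply: fps_prod_coef0 => t _; exact: shA0.
have := @sdefect_prod K r g mu (xs s k) s m _ (index_enum 'I_r) (fun j => cartan g j i < 0)
  (fun j => \prod_(1 <= t < `|cartan g j i|%N.+1) fps_shift (- dp i j - t%:R * d j) (A j))
  (fun j n => f j n *+ `|cartan g j i|%N) k (- dp i k, -1) v
  (index_enum_uniq _) (fun j _ => T0 j).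
rewrite mem_index_enum /=.
have -> : (if cartan g k i < 0 then (- dp i k, -1) else v) =
    (if k == i then (d k, -1) else (- dp i k, -1)).
  rewrite /v; case: (eqVneq k i) => [->|ki]; first by rewrite cartan_diag.
  case: ltgtP (cartan_offdiag g ki) => // ck0 _.
  suff -> : dp i k = 0 by rewrite oppr0.
  by rewrite /dpair cartan_sym ck0 mulr0 mul0r.
apply=> [j _ jk|ck].
  have := shifts_defect (- dp i j) j `|cartan g j i|%N.
  by rewrite (negPf jk) mulr0 subr0; exact: sdefect_diag.
have := shifts_defect (- dp i k) k `|cartan g k i|%N; rewrite eqxx.
have ki : k != i by apply: contraTneq ck => ->; rewrite cartan_diag.
rewrite /v (negPf ki).
have -> // : - dp i k - `|cartan g k i|%:R * d k = dp i k.
rewrite -[_%:R]/((`|cartan g k i|%N)%:Z%:~R) abszE ltr0_norm // intrN mulNr opprK mulrC.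
by rewrite -dpair_double addKr.
Qed.

Let square_defect i :
  sdef (fps_inv (A i * fps_shift (- d i) (A i)))
    (if k == i then (- d k, -1) else (- dp i k, -1))
    (if k == i then (d k, -1) else (- dp i k, -1))
    (fun n => - (f i n + f i n)).
Proof.
apply: sdefect_inv; first by rewrite fcoef0M A0 shA0 mulr1.
have [<-|ki] := eqVneq k i.
  have := Af k; rewrite eqxx => Ak; have := sdefect_shift (- d k) Ak.
  by rewrite /= subrr sub0r; apply: sdefect_comp Ak; rewrite ?A0 ?shA0.
apply: sdefect_comp; rewrite ?A0 ?shA0 //; last by apply: Af_diag; rewrite eq_sym.
by have := Af i; rewrite eq_sym (negPf ki); exact: sdefect_diag.
Qed.

(** In the equation of A the series xi_i has no defect, and the other side has
    the leading defect - sum_j c_ji f_j. *)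
Lemma gklo_top_defect j n : f j n = 0.
Proof.
apply: (@sum_cartan_eq0 _ _ _ _ (fun j => f j n)) => i.
have xid := xibar_defect K g mu s m i k.
have [_ Axi] := hA; rewrite Axi in xid.
have I0 : fps_inv (A i * fps_shift (- d i) (A i)) 0%N = 1 by exact: fps_inv0.
have P0 : (\prod_(j < r | cartan g j i < 0) \prod_(1 <= t < `|cartan g j i|%N.+1)
          fps_shift (- dp i j - t%:R * d j) (A j)) 0%N = 1.
  by apply: fps_prod_coef0 => j' _; apply: fps_prod_coef0 => t _; exact: shA0.
have := sdefect_comp I0 P0 (square_defect i) (shifts_prod_defect i).
have -> : (if k == i then (- d k, -1) else (- dp i k, -1)) = (- dp i k, -1).
  by case: eqP => // ->; rewrite dpair_diag.
have -> : (if k == i then (d k, -1) else (dp i k, -1)) = (dp i k, -1).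
  by case: eqP => // ->; rewrite dpair_diag.
move=> /(sdefect_uniq xid) /(_ n) /= /esym/eqP.
rewrite addrC subr_eq0 => /eqP sumE.
rewrite (bigID (fun l => cartan g l i < 0)) /= addrC (bigD1 i) ?cartan_diag //=.
rewrite big1 ?addr0 => [|l /andP[/negP cl li]]; last first.
  by case: ltgtP (cartan_offdiag g li) cl => // ->.
apply/eqP; rewrite addr_eq0; apply/eqP.
rewrite -[_ *~ 2]/(f i n + f i n) -sumE -sumrN; apply: eq_bigr => l cl.
by rewrite -[_ *+ _]/(_ *~ `|cartan g l i|%N%:Z) abszE ltr0_norm // mulrNz.
Qed.


End Node.
(** By induction on the degree m, the defects of the A_i vanish below m, and those
    in degree m solve the linear system whose matrix is the Cartan matrix.  The
    fraction for x^+_i is (z - sigma) / (z - sigma + d_i). *)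
Theorem gklo_defect s m k i :
  sdefect (xs s k) s m (A i) (if i == k then d k else 0, -1) (0, -1) (fun=> 0).
Proof.
elim/ltn_ind: m i => m IH i.
pose f j n := (if s then defect (xs s k) (A j) (if j == k then d k else 0, -1) (0, -1) n
               else defect (xs s k) (A j) (0, -1) (if j == k then d k else 0, -1) n) m.
have Af j : sdefect (xs s k) s m (A j) (if j == k then d k else 0, -1) (0, -1) (f j).
  by rewrite /f; move: IH; case: (s) => IH n /=; split=> // l lm; have [_ ->] := IH l lm j n.
have f0 : f i = fun=> 0 by apply/funext => n; exact: (gklo_top_defect Af).
by rewrite -f0.
Qed.

End GKLO.

(** * The S-series *)

Lemma defect_diag (K : numClosedFieldType) (A : pzAlgType K) (x : nat -> A) g u :
  defect x g u u = lin u (defect x g (0, 0) (0, 0)).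
Proof. by rewrite lin_defect lin0. Qed.

Lemma sdefect_exact (K : numClosedFieldType) (A : pzAlgType K) (x : nat -> A) s g u v :
  (forall m, sdefect x s m g u v (fun=> 0)) ->
  (if s then defect x g u v else defect x g v u) = fun=> 0.
Proof.
move=> D0; apply/funext => n; apply: fpsP => m.
by move: D0; case: s => D0; have [_ ->] := D0 m n.
Qed.

Lemma exact_sdefect (K : numClosedFieldType) (A : pzAlgType K) (x : nat -> A) s g u v :
  (forall n, (if s then defect x g u v else defect x g v u) n = 0) ->
  forall m, sdefect x s m g u v (fun=> 0).
Proof. by case: s => D0 m n /=; rewrite D0. Qed.

Section SSeries.
Variables (K : numClosedFieldType) (r : nat) (g : simple_datum r) (mu : 'rV[int]_r).
Local Notation Y := (Yangian K g mu).
Local Notation xs := (yx K g mu).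
Local Notation d := (dnode K g).

Variables A S : 'I_r -> fps Y.
Hypotheses (hA : is_GKLO A) (hS : is_Sseries A S).

Let A0 i : A i 0%N = 1. Proof. by have [h _] := hA; case: (h i). Qed.
Let S0 i : S i 0%N = 1. Proof. by have [[h _] _] := hS i. Qed.
Let d0 i : d i != 0. Proof. by rewrite pnatr_eq0 -lt0n symd_gt0. Qed.

Let a i : Y := gklo_coef A i 0.
Let W i : fps Y := fps_pow (zratio (d i)) (a i).
Let W0 i : W i 0%N = 1. Proof. exact: fps_pow_coef0. Qed.

Let aE i : algc (d i) * a i = A i 1%N.
Proof.
by rewrite /a /gklo_coef fps_log1 mulrA -rmorphM mulfV // rmorph1 mul1r.
Qed.

Let W1 i : W i 1%N = - A i 1%N.
Proof.
by rewrite /W fps_pow_coef1 aE.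
Qed.

Let a_comm s i k n :
  a i * xs s k n = xs s k n * a i - algc (if i == k then (if s then 1 else -1) else 0) * xs s k n.
Proof.
have : A i 1%N * xs s k n - xs s k n * A i 1%N =
    - (algc (if i == k then if s then d i else - d i else 0) * xs s k n).
  have := sdefect_exact (fun m => gklo_defect hA s m k i).
  have alg0 (y : Y) : algc (0 : K) * y = 0 by rewrite rmorph0 mul0r.
  case: (s) => /(congr1 (fun F : nat -> fps Y => F n 1%N)); rewrite defect_coefS A0.
  - rewrite !mul1r !mulr1 alg0 add0r rmorphN1 !mulN1r opprD opprK !addrA.
    rewrite (ACl ((1*4*2)*(3*5)))%AC /= addNr addr0 => /eqP; rewrite addr_eq0 => /eqP ->.
    by case: eqP => [->|].
  - rewrite !mul1r !mulr1 alg0 add0r rmorphN1 !mulN1r opprD opprB !addrA.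
    rewrite (ACl ((1*3*5)*(2*4)))%AC /= addNr addr0 => /eqP; rewrite subr_eq0 => /eqP ->.
    by case: eqP => [->|]; rewrite ?alg0 ?oppr0 // rmorphN mulNr opprK.
rewrite -aE => E; apply/eqP; rewrite -subr_eq0; apply/eqP.
apply: (algc_mul_eq0 (d0 i)).
have C : xs s k n * (algc (d i) * a i) = algc (d i) * (xs s k n * a i).
  by rewrite mulrA -algcC mulrA.
rewrite C -mulrA in E; rewrite !mulrBr opprB addrCA E mulrA -rmorphM.
rewrite (_ : d i * _ = if i == k then if s then d i else - d i else 0) ?subrr //.
by case: (i == k) (s) => [] []; rewrite ?mulr1 ?mulrN1 ?mulr0.
Qed.

(** The zeroth coefficient a_i of log A_i / d_i satisfies [a_i, x^+_i] = - x^+_i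
   and [a_i, x^-_i] = x^-_i, hence (z / (z + d_i))^a_i conjugates x^+_i by
   (z + d_i) / z. *)
Let W_defect s i k m :
  sdefect (xs s k) s m (W i) (0, 0) (if i == k then d i else 0, 0) (fun=> 0).
Proof.
have xE t n : lin (0, 0) (fun l => fconst (xs t k l)) n = fconst (xs t k n) by rewrite lin0.
have kE : 1 + algc (d i) * zvar Y = fscal Y (1 + algc (d i) * zvar K^o).
  by rewrite fscalD fscal1 fscalM fscal_algc fscal_zvar.
move: m; apply: exact_sdefect => n; case: eqP (a_comm s i k n) => [_|_] ac.
  case: (s) ac => ac; rewrite /defect xE lin_scal kE.
    by rewrite /W fps_pow_lower; [rewrite mulrA subrr|rewrite ac rmorph1 mul1r].
  by rewrite /W fps_pow_raise; [rewrite subrr|rewrite ac rmorphN1 mulN1r opprK].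
rewrite if_same /defect xE /W fps_pow_comm ?subrr //.
by rewrite ac rmorph0 mul0r subr0.
Qed.

(** S_i conjugates x^+_i by f(z) = z / (z - sigma), the solution of
    f(z + d_i) = f(z) (z - sigma) / (z - sigma + d_i) (z + d_i) / z.  Composing the
    known conjugations by A_i and by W_i = (z / (z + d_i))^a_i, the defect e of S_i
    satisfies e(z + d_i) = e(z) A_i(z) W_i(z), up to operators in the case of x^-_i,
    and A_i W_i = 1 + O(z^-2). *)
Lemma S_defect s m k i :
  sdefect (xs s k) s m (S i) (0, if i == k then -1 else 0) (0, 0) (fun=> 0).
Proof.
have [_ shiftS] := hS i; rewrite -/(a i) -/(W i) in shiftS.
have Aex := sdefect_exact (fun m => gklo_defect hA s m k i).
have Wex := sdefect_exact (fun m => W_defect s i k m).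
have B0 : (A i * W i) 0%N = 1 by rewrite fcoef0M A0 W0 mulr1.
have B1 : (A i * W i) 1%N = 0 by rewrite fcoef1M A0 W0 W1 mulr1 mul1r addNr.
have e0 u v n : defect (xs s k) (S i) u v n 0%N = 0.
  by rewrite defect_coef0 S0 mul1r mulr1 subrr.
have lin_zero u : lin u (fun=> 0 : fps Y) = fun=> 0.
  by apply/funext => n; rewrite /lin !mulr0 addr0 mulr0 addr0.
suff E0 : (if s then defect (xs s k) (S i) (0, if i == k then -1 else 0) (0, 0)
           else defect (xs s k) (S i) (0, 0) (0, if i == k then -1 else 0)) = fun=> 0.
  by apply: exact_sdefect => n; rewrite E0.
have [ik|ik] := eqVneq i k; last first.
  rewrite (negPf ik) in Aex Wex.
  have {}Aex : defect (xs s k) (A i) (0, 0) (0, 0) = fun=> 0.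
    by apply: (@lin_eq0 _ _ (0, -1)); rewrite -defect_diag; case: (s) Aex.
  have {}Wex : defect (xs s k) (W i) (0, 0) (0, 0) = fun=> 0 by case: (s) Wex.
  rewrite if_same; apply: (@shift_fix_eq0 _ _ (d i) 0 _ (A i * W i)) => //.
  rewrite lin0; have := defect_shift (xs s k) (d i) (S i) (0, 0) (0, 0).
  rewrite /= add0r defect_diag -lin_scal => /lin_inj <-; congr lin.
  have := defect_comp (xs s k) (S i) (A i * W i) (0, 0) (0, 0) (0, 0).
  have := defect_comp (xs s k) (A i) (W i) (0, 0) (0, 0) (0, 0).
  rewrite Aex Wex !lin0 => AW; rewrite mulrA -shiftS => ->.
  by apply/funext => n; rewrite AW mulr0 mul0r addr0 mulr0 add0r.
subst k; rewrite eqxx in Aex Wex *.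
case: s Aex Wex e0 => Aex Wex e0.
  have SA : defect (xs true i) (S i * A i) (d i, -1) (0, 0) =
      fun n => defect (xs true i) (S i) (0, -1) (0, 0) n * A i.
    have := defect_comp_rev (xs true i) (A i) (S i) (d i, -1) (0, -1) (0, 0).
    rewrite Aex lin_zero => E; apply: (@lin_inj _ _ (0, -1)); rewrite E linMr.
    by apply/funext => n; rewrite mulr0 add0r.
  have := defect_comp (xs true i) (S i * A i) (W i) (d i, -1) (0, 0) (d i, 0).
  rewrite Wex lin_zero lin0 -shiftS SA linMr => E.
  apply: (@shift_fix_eq0 _ _ (d i) 0 _ (A i * W i)) => //.
  have := defect_shift (xs true i) (d i) (S i) (0, -1) (0, 0).
  rewrite /fst /snd !add0r E => sh; rewrite lin0 lin_scal -sh linMr.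
  by apply/funext => n; rewrite mulr0 add0r mulrA.
have SA : lin (0, -1) (defect (xs false i) (S i * A i) (0, 0) (d i, -1)) =
    lin (d i, -1) (fun n => defect (xs false i) (S i) (0, 0) (0, -1) n * A i).
  rewrite (defect_comp (xs false i) (S i) (A i) (0, 0) (0, -1) (d i, -1)).
  rewrite Aex lin_zero linMr.
  by apply/funext => n; rewrite mulr0 add0r.
have SAW : defect (xs false i) (fps_shift (d i) (S i)) (d i, 0) (d i, -1) =
    fun n => defect (xs false i) (S i * A i) (0, 0) (d i, -1) n * W i.
  have := defect_comp_rev (xs false i) (W i) (S i * A i) (d i, 0) (0, 0) (d i, -1).
  rewrite !lin0 Wex -shiftS => ->.
  by apply/funext => n; rewrite mulr0 add0r.
apply: (@shift_fix_eq0 _ _ (d i) (-1) _ (A i * W i)) => //.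
have := defect_shift (xs false i) (d i) (S i) (0, 0) (0, -1).
rewrite /fst /snd !add0r => sh; rewrite lin_scal -sh SAW linMr SA !linMr.
by apply/funext => n; rewrite mulrA.
Qed.

End SSeries.

Section Lins.
Variables (K : numClosedFieldType) (A : pzAlgType K).
Implicit Types (X : nat -> fps A) (l : seq K) (c : K).

(** For the list l of the n roots of a monic polynomial p and c = -1, this is the
    operator (- z)^-n p(sigma - z). *)
Definition lins c l X : nat -> fps A := foldr (fun a => lin (a, c)) X l.

Lemma linsMl c l f X : lins c l (fun n => f * X n) = fun n => f * lins c l X n.
Proof. by elim: l => [//|a l /= ->]; rewrite linMl. Qed.

Lemma linsMr c l f X : lins c l (fun n => X n * f) = fun n => lins c l X n * f.
Proof. by elim: l => [//|a l /= ->]; rewrite linMr. Qed.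

Lemma linsC c c' l l' X : lins c l (lins c' l' X) = lins c' l' (lins c l X).
Proof.
have linsC1 u m Y : lin u (lins c' m Y) = lins c' m (lin u Y).
  by elim: m => [//|b m IH] /=; rewrite linC IH.
by elim: l => [//|a l /= ->]; rewrite linsC1.
Qed.

Lemma lins_cat c l l' X : lins c (l ++ l') X = lins c l (lins c l' X).
Proof. by rewrite /lins foldr_cat. Qed.

(** (- z)^-n p(- z), for the monic polynomial p with the n roots l. *)
Definition kap l : fps K^o := \prod_(a <- l) (1 + algc a * zvar K^o).

Lemma lins0 l X : lins 0 l X = fun n => fscal A (kap l) * X n.
Proof.
apply/funext => n; elim: l => [|a l IH]; first by rewrite /kap big_nil fscal1 mul1r.
rewrite /= lin_scal /= IH /kap big_cons fscalM -mulrA.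
by rewrite fscalD fscal1 fscalM fscal_algc fscal_zvar.
Qed.

Variable x : nat -> A.
Let xc n : fps A := fconst (x n).

(** In terms of the polynomial p with roots l: f p(sigma - z) x = p(- z) x f for
    x^+, and f p(- z) x = p(sigma - z) x f for x^-. *)
Definition conjugates (s : bool) (f : fps A) l : Prop :=
  if s then forall n, f * lins (-1) l xc n = fscal A (kap l) * (fconst (x n) * f)
  else forall n, f * (fscal A (kap l) * fconst (x n)) = lins (-1) l xc n * f.

Lemma conjugates1 s : conjugates s 1 [::].
Proof.
by case: s => n; rewrite /= /kap big_nil fscal1 mulr1 !mul1r.
Qed.

Lemma conjugates_comm s f : (forall n, f * fconst (x n) = fconst (x n) * f) -> conjugates s f [::].
Proof. by case: s => fx n; rewrite /= /kap big_nil fscal1 mul1r fx. Qed.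

Lemma conjugatesM s f f' l l' : conjugates s f l -> conjugates s f' l' -> conjugates s (f * f') (l ++ l').
Proof.
have kapE : fscal A (kap (l ++ l')) = fscal A (kap l) * fscal A (kap l').
  by rewrite /kap big_cat fscalM.
rewrite /conjugates kapE; case: s => fl fl' n; rewrite lins_cat.
  have := congr1 (fun F : nat -> fps A => F n) (linsMl (-1) l f' (lins (-1) l' xc)).
  rewrite (_ : (fun k => f' * _) = fun k => fscal A (kap l') * (xc k * f')); last first.
    by apply/funext => k; exact: fl'.
  rewrite linsMl linsMr => E; rewrite -mulrA -{}E fscalCA mulrA -fscalM fps_mulC fscalM.
  by rewrite -!mulrA; congr (_ * _); rewrite mulrA fl !mulrA.
have := congr1 (fun F : nat -> fps A => F n) (linsMr (-1) l' f (lins (-1) l xc)).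
rewrite (_ : (fun k => _ * f) = fun k => f * (fscal A (kap l) * xc k)); last first.
  by apply/funext => k; rewrite fl.
rewrite !linsMl linsC => E; rewrite [RHS]mulrA -{}E -!mulrA -fl'.
by rewrite [f' * _]fscalCA.
Qed.

Lemma conjugates_exact s f a :
  (if s then defect x f (a, -1) (a, 0) else defect x f (a, 0) (a, -1)) = (fun=> 0) ->
  conjugates s f [:: a].
Proof.
have kE X n : fscal A (kap [:: a]) * X n = lin (a, 0) X n by rewrite -[RHS]/(lins 0 [:: a] X n) lins0.
rewrite /conjugates; case: s => fD n; have := congr1 (fun F : nat -> fps A => F n) fD => /eqP.
  by rewrite /defect subr_eq0 => /eqP; rewrite -kE mulrA.
by rewrite /defect subr_eq0 => /eqP; rewrite -kE.
Qed.

Lemma conjugates_diag s f u : defect x f u u = (fun=> 0) -> conjugates s f [::].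
Proof.
rewrite defect_diag => /lin_eq0 f0; apply: conjugates_comm => n.
have /eqP := congr1 (fun F : nat -> fps A => F n) f0.
by rewrite /defect !lin0 subr_eq0 => /eqP.
Qed.

Lemma conjugates_prod (I : Type) s (L : seq I) (F : I -> fps A) (l : I -> seq K) :
  (forall j, conjugates s (F j) (l j)) ->
  conjugates s (\prod_(j <- L) F j) (flatten [seq l j | j <- L]).
Proof.
move=> Fl; elim: L => [|j L IH]; first by rewrite big_nil; exact: conjugates1.
by rewrite big_cons; exact: conjugatesM.
Qed.

End Lins.

Section Spoly.
Variables (K : numClosedFieldType) (r : nat) (g : simple_datum r) (mu : 'rV[int]_r).
Local Notation Y := (Yangian K g mu).
Variables (p : 'I_r -> {poly K}) (A S : 'I_r -> fps Y).
Hypotheses (hA : is_GKLO A) (hS : is_Sseries A S).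

(** S_k(w + a) conjugates x^+_k by (w + a) / (w + a - sigma), and the S_i with i
    different from k commute with x^+_k; this is taken over the roots a of p_k. *)
Lemma Spoly_conjugates s k : conjugates (yx K g mu s k) s (Spoly p S) (proots (p k)).
Proof.
have <- : flatten [seq (if i == k then proots (p i) else [::]) | i <- index_enum 'I_r] = proots (p k).
  have : uniq (index_enum 'I_r) := index_enum_uniq _.
  have : k \in index_enum 'I_r := mem_index_enum _.
  elim: (index_enum _) => //= i e IH; rewrite inE => /predU1P[<-|ke] /andP[ie ue].
    rewrite eqxx (_ : flatten _ = [::]) ?cats0 //.
    elim: (e) ie => //= j e' IH'; rewrite inE negb_or => /andP[kj /IH' ->].
    by rewrite eq_sym (negPf kj).
  rewrite (_ : (i == k) = false) ?IH //; apply: contraNF ie => /eqP ->; exact: ke.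
apply: conjugates_prod => i.
have -> : (if i == k then proots (p i) else [::]) =
    flatten [seq (if i == k then [:: a] else [::]) | a <- proots (p i)].
  by case: eqP => _; elim: (proots _) => //= a l <-.
apply: conjugates_prod => a.
have SD m : sdefect (yx K g mu s k) s m (fps_shift a (S i)) (a, if i == k then -1 else 0) (a, 0) (fun=> 0).
  by have := sdefect_shift a (S_defect hA hS s m k i); rewrite /fst /snd add0r.
have {SD} := sdefect_exact SD.
case: eqP => ik SD.
  exact: conjugates_exact.
by apply: (@conjugates_diag _ _ _ _ _ (a, 0)); case: (s) SD.
Qed.

Lemma Spoly_Yzero n : Yzero (Spoly p S n).
Proof.
have YzM (f h : fps Y) : (forall n, Yzero (f n)) -> (forall n, Yzero (h n)) ->
    forall n, Yzero ((f * h) n).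
  move=> fY hY m; rewrite fcoefM; apply: (big_ind (@Yzero K r g mu)).
  - by rewrite -(rmorph0 (@algc K Y)); exact: Yzero_scal.
  - by move=> y z; exact: Yzero_add.
  - by move=> i _; exact: Yzero_mul.
have Yz1 m : Yzero ((1 : fps Y) m).
  by rewrite fcoef1 -(rmorph_nat (@algc K Y)); exact: Yzero_scal.
have Yzsh b (f : fps Y) : (forall n, Yzero (f n)) -> forall n, Yzero (fps_shift b f n).
  move=> fY m; apply: (big_ind (@Yzero K r g mu)).
  - by rewrite -(rmorph0 (@algc K Y)); exact: Yzero_scal.
  - by move=> y z; exact: Yzero_add.
  - by move=> i _; apply: Yzero_mul => //; exact: Yzero_scal.
rewrite /Spoly; elim: (index_enum 'I_r) n => [|i e IH] n; first by rewrite big_nil.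
rewrite big_cons; apply: (YzM) => // {}n.
elim: (proots _) n => [|a l IHl] n; first by rewrite big_nil.
by rewrite big_cons; apply: (YzM) => //; apply: (Yzsh) => m; have [[_ h] _] := hS i; exact: h.
Qed.

Lemma Spoly0 : Spoly p S 0%N = 1.
Proof.
apply: fps_prod_coef0 => i _; apply: fps_prod_coef0 => a _.
have [[h _] _] := hS i; have : lead 0 (S i) 1 by [].
by case/(lead_shift a).
Qed.

End Spoly.

(** * Laurent series in w^-1 *)

(** The Laurent series w^N f(w^-1). *)
Definition Lau (A : pzRingType) (N : int) (f : fps A) : int -> A :=
  fun k => match N - k with Posz m => f m | Negz _ => 0 end.

Definition bounded_by (V : zmodType) (B : int) (h : int -> V) : Prop :=
  forall n, B < n -> h n = 0.

Section LaurentAction.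
Variables (A : pzRingType) (V : lmodType A).
Implicit Types (f : fps A) (h : int -> V) (B N : int).

(** Both series are bounded above, so that finitely many terms matter for each
    coefficient. *)
Lemma lact_LauE B N f h n M : bounded_by B h -> B < n - N + M%:Z ->
  lact (Lau N f) h n = \sum_(m < M) f m *: h (n - N + m%:Z).
Proof.
move=> hB BM; rewrite /lact.
have u : uniq [seq N - Posz m | m <- index_iota 0 M].
  by rewrite map_inj_uniq ?iota_uniq // => i j /addrI /oppr_inj [].
rewrite (fsbigE _ _ u) //; last first.
  move=> k _ kM /=; rewrite /Lau; case Nk: (N - k) => [m|m]; last by rewrite scale0r.
  have kE : k = N - m%:Z by rewrite -Nk subKr.
  rewrite hB ?scaler0 //; rewrite kE opprB addrA addrAC; apply: lt_le_trans BM _.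
  rewrite lerD2l lez_nat leqNgt; apply: contra kM => mM.
  by rewrite kE; apply/mapP; exists m; rewrite ?mem_index_iota.
rewrite big_map [LHS](eq_bigl predT) => [|k]; last by rewrite in_setT.
rewrite big_mkord; apply: eq_bigr => m _.
by rewrite /Lau subKr opprB addrA addrAC.
Qed.

Lemma Lau_bounded B N f h : bounded_by B h -> bounded_by (B + N) (lact (Lau N f) h).
Proof.
move=> hB n BN; rewrite (@lact_LauE B _ _ _ _ 0) ?big_ord0 //.
by rewrite addr0 ltrBrDr.
Qed.

Let large B n : exists M : nat, B < n + M%:Z.
Proof.
by exists (`|B - n|%N.+1); lia.
Qed.

(** All operators on V^w in the sequel are of the form w^N f(w^-1); by this
    lemma, identities between them are identities of power series. *)
Lemma lact_Lau_comp B N N' f f' h : bounded_by B h ->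
  lact (Lau N f) (lact (Lau N' f') h) = lact (Lau (N + N') (f * f')) h.
Proof.
move=> hB; apply/funext => n; have [M nM] := large (B + N') (n - N).
have nM' : B < n - (N + N') + M%:Z by lia.
rewrite (lact_LauE _ (Lau_bounded f' hB) nM) (lact_LauE _ hB nM').
transitivity (\sum_(i < M) \sum_(j < M - i)
    (f i * f' j) *: h (n - (N + N') + (i + j)%N%:Z)).
  apply: eq_bigr => i _; rewrite (@lact_LauE B _ _ _ _ (M - i)) //; last first.
    by have := ltn_ord i; lia.
  rewrite scaler_sumr; apply: eq_bigr => j _; rewrite scalerA; congr (_ *: h _).
  by lia.
rewrite -(sum_triangle (fun i j => (f i * f' j) *: h (n - (N + N') + (i + j)%N%:Z))).
apply: eq_bigr => k _; rewrite fcoefM scaler_suml; apply: eq_bigr => i _.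
by rewrite subnKC ?leq_ord.
Qed.

Lemma lact_LauD B N f h h' : bounded_by B h -> bounded_by B h' ->
  lact (Lau N f) (h + h') = lact (Lau N f) h + lact (Lau N f) h'.
Proof.
move=> hB hB'; apply/funext => n; have [M nM] := large B (n - N).
have hB2 : bounded_by B (h + h').
  by move=> k Bk; rewrite -[LHS]/(h k + h' k) hB // hB' // addr0.
rewrite -[RHS]/(lact (Lau N f) h n + lact (Lau N f) h' n).
rewrite !(@lact_LauE B _ _ _ _ M) // -big_split; apply: eq_bigr => m _.
exact: scalerDr.
Qed.

Lemma lact_zero (c : int -> A) : lact c (0 : int -> V) = 0.
Proof.
apply/funext => n; rewrite /lact fsbig1 // => k _.
exact: scaler0.
Qed.

Lemma lact_Lau1 B h : bounded_by B h -> lact (Lau 0 1) h = h.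
Proof.
move=> hB; apply/funext => n; have [M nM] := large B n.
have nM' : B < n - 0 + M.+1%:Z by rewrite subr0 (lt_trans nM) // ltrD2l ltz_nat.
rewrite (lact_LauE _ hB nM') big_ord_recl /= scale1r subr0 addr0 big1 ?addr0 //.
by move=> i _; rewrite scale0r.
Qed.

End LaurentAction.

Lemma lau_of_fpsE (A : pzRingType) (f : fps A) : lau_of_fps f = Lau 0 f.
Proof. by apply/funext => k; rewrite /lau_of_fps /Lau sub0r. Qed.

(** The polynomial P(w) of degree at most M is w^M times this series. *)
Definition wrev (A : pzRingType) (M : nat) (P : nat -> A) : fps A :=
  Fps (fun m => if (m <= M)%N then P (M - m)%N else 0).

Lemma lau_of_wpolyE (A : pzRingType) (M : nat) (P : wpoly A) :
  (forall k, (M < k)%N -> P k = 0) -> lau_of_wpoly P = Lau M%:Z (wrev M P).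
Proof.
move=> PM; apply/funext => -[k|k]; rewrite /lau_of_wpoly /Lau; last first.
  case E: (M%:Z - Negz k) => [m|//]; rewrite /= ifF //; lia.
case E: (M%:Z - k%:Z) => [m|m]; last by apply: PM; lia.
have -> : k = (M - m)%N by lia.
by rewrite /= ifT //; lia.
Qed.

Section ScalarLaurent.
Variable K : numClosedFieldType.
Implicit Types (f : fps K^o) (N : int).

Lemma lmul_Lau N N' f f' : lmul (Lau N f) (Lau N' f') = Lau (N + N') (f * f').
Proof.
apply/funext => n.
have b' : bounded_by N' (Lau N' f' : int -> K^o).
  move=> k Nk; rewrite /Lau; case E: (N' - k) => [m|//].
  by move: Nk; rewrite -subr_lt0 E.
rewrite -[LHS]/(@lact K K^o (Lau N f) (Lau N' f') n) [RHS]/Lau.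
case E: (N + N' - n) => [k|k].
  rewrite (@lact_LauE _ _ N' _ _ _ _ k.+1) //.
        apply: eq_bigr => i _; congr (_ * _); rewrite /Lau.
    have -> : N' - (n - N + i%:Z) = (k - i)%N%:Z.
      by rewrite -subzn ?leq_ord // -E; ring.
    by [].
  by lia.
rewrite (@lact_LauE _ _ N' _ _ _ _ 0) ?big_ord0 //.
by lia.
Qed.

Lemma lone_Lau : @lone K = Lau 0 1.
Proof.
apply/funext => k; rewrite /lone /Lau sub0r; case: k => [[|k]|k] //=.
Qed.

End ScalarLaurent.

(** * The scalars of the grading operator *)

HB.instance Definition _ (A : comPzRingType) :=
  GRing.PzRing_hasCommutativeMul.Build (fps A) (@fps_mulC A).

Section Exprz.
Variables (K : numClosedFieldType) (f : fps K^o).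
Hypothesis f0 : f 0%N = 1.

Lemma fps_exprz_pred b : fps_exprz f (b - 1) * f = fps_exprz f b.
Proof.
case: b => [[|n]|n].
- by rewrite sub0r -[- 1]/(Negz 0) /= expr1 fps_Vmul.
- by rewrite (_ : Posz n.+1 - 1 = Posz n) /= -?exprSr //; lia.
- rewrite (_ : Negz n - 1 = Negz n.+1); last by lia.
  by rewrite /= exprSr -mulrA fps_Vmul // mulr1.
Qed.

Lemma fps_exprzV b : fps_exprz f b * fps_exprz f (- b) = 1.
Proof.
case: b => [[|n]|n]; first by rewrite oppr0 /= !expr0 mulr1.
- by rewrite -NegzE /= -exprMn fps_mulV // expr1n.
- by rewrite NegzE opprK /= -exprMn fps_Vmul // expr1n.
Qed.

End Exprz.

Section Dscalar.
Variables (K : numClosedFieldType) (r : nat) (p : 'I_r -> {poly K}).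
Hypothesis p_monic : forall i, p i \is monic.
Implicit Types beta : 'rV[int]_r.

(** p_i(- w) *)
Let q i : {poly K} := p i \Po (- 'X).
Let N i := size (proots (p i)).

(** p(- w), for the monic polynomial p with roots l. *)
Let negprod (l : seq K) : {poly K} := \prod_(a <- l) (- 'X - a%:P).

Lemma monic_proots (s : {poly K}) : s \is monic -> s = \prod_(a <- proots s) ('X - a%:P).
Proof.
move=> /monicP s1; rewrite /proots; case: (closed_field_poly_normal s) => l /= {1}->.
by rewrite s1 scale1r.
Qed.

Let qE i : q i = negprod (proots (p i)).
Proof.
rewrite /q {1}(monic_proots (p_monic i)) rmorph_prod; apply: eq_bigr => a _ /=.
by rewrite comp_polyB comp_polyX comp_polyC.
Qed.

Let negprodE l : negprod l = (-1) ^+ size l *: \prod_(a <- map -%R l) ('X - a%:P).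
Proof.
rewrite big_map; elim: l => [|a l IH]; first by rewrite /negprod !big_nil scale1r.
rewrite /negprod !big_cons -/(negprod l) IH /= exprS mulN1r scaleNr -scalerAr.
by rewrite -scalerN -mulNr polyCN opprK opprD.
Qed.

Let size_negprod l : size (negprod l) = (size l).+1.
Proof.
by rewrite negprodE size_scale ?signr_eq0 // size_prod_XsubC size_map.
Qed.

Let lead_negprod l : lead_coef (negprod l) = (-1) ^+ size l.
Proof. by rewrite negprodE lead_coefZ (monicP (monic_prod_XsubC _ _ _)) mulr1. Qed.

Let negprod_rev l : wrev (size l) (fun j => (negprod l)`_j : K^o) =
  algc ((-1) ^+ size l : K) * kap l.
Proof.
elim: l => [|a l IH]; apply: fpsP => m.
  rewrite /negprod /kap !big_nil mulr1 /=.
  by case: m => [|m] //=; rewrite coef1.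
have kapS : kap (a :: l) = (1 + algc a * zvar K^o) * kap l by rewrite /kap big_cons.
have -> : (algc ((-1) ^+ size (a :: l) : K) * kap (a :: l)) m =
    - (wrev (size l) (fun j => (negprod l)`_j : K^o) m)
    - a * (if m is j.+1 then wrev (size l) (fun j => (negprod l)`_j : K^o) j else 0).
  rewrite kapS IH exprS rmorphM rmorphN1 mulN1r mulNr fcoefN mulrCA mulrDl mul1r fcoefD.
  rewrite -[X in - (_ + X)]/((algc a * zvar K^o * _) m) -mulrA fcoef_algcM zvarM opprD.
  by [].
have coefE j : (negprod (a :: l))`_j =
    - (if j is i.+1 then (negprod l)`_i else 0) - a * (negprod l)`_j.
  rewrite /negprod big_cons -/(negprod l) mulrBl mulNr coefB coefN coefXM coefCM.
  by case: j.
have big0 j : (size l < j)%N -> (negprod l)`_j = 0.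
  by move=> lj; rewrite nth_default // size_negprod.
rewrite /wrev /= coefE.
case: m => [|m]; first by rewrite /= !subn0 (big0 (size l).+1).
rewrite subSS ltnS; case: ltngtP => [lm|lm|->]; last by rewrite subnn.
- by rewrite (_ : size l - m = (size l - m.+1).+1)%N ?subnSK //; lia.
- by rewrite mulr0 subr0 oppr0.
Qed.

(** p_i(- w) divided by w^(N i). *)
Let e i : fps K^o := algc (lead_coef (q i)) * rev_fps (q i).

Let rev_kap i : e i = algc ((-1) ^+ N i : K) * kap (proots (p i)).
Proof.
rewrite -negprod_rev -qE; apply: fpsP => m; rewrite /e fcoef_algcM /=.
rewrite qE size_negprod ltnS.
have l0 : lead_coef (negprod (proots (p i))) != 0 by rewrite lead_negprod signr_eq0.
case: ifP => _; last by rewrite mulr0.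
by rewrite [LHS]mulrC divfK.
Qed.

(** The degree, and the series in w^-1, of prod_i p_i(- w)^(- beta_i). *)
Definition DN beta : int := \sum_i (N i)%:Z * (- beta 0 i).
Definition DE beta : fps K^o :=
  \prod_i (algc (lead_coef (q i) ^ (- beta 0 i)) * fps_exprz (rev_fps (q i)) (- beta 0 i)).

Lemma Dscalar_Lau beta : Dscalar p beta = Lau (DN beta) (DE beta).
Proof.
rewrite /Dscalar /DN /DE; elim: (index_enum 'I_r) => [|i l IH].
  by rewrite !big_nil lone_Lau.
rewrite !big_cons IH -lmul_Lau; congr lmul; apply/funext => k.
have -> : pairing (varpi i) beta = beta 0 i.
  rewrite /pairing (bigD1 i) //= big1 ?addr0 => [|j ji]; last first.
    by rewrite /varpi mxE (negPf ji) andbF mul0r.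
  by rewrite /varpi mxE !eqxx mul1r.
rewrite /lexp /Lau -/(q i) (_ : (size (q i)).-1 = N i); last by rewrite qE size_negprod.
by case: (_ - k) => [m|m]; rewrite ?mulr0 // fcoef_algcM.
Qed.

Let lead0 i : lead_coef (q i) != 0.
Proof. by rewrite qE lead_negprod signr_eq0. Qed.

Let rev0 i : rev_fps (q i) 0%N = 1.
Proof.
have sE : size (q i) = (N i).+1 by rewrite qE size_negprod.
have lE : (q i)`_(N i) = lead_coef (q i) by rewrite lead_coefE sE.
by rewrite /rev_fps /= sE subn0 lE divff ?lead0.
Qed.

(** Adding alpha_k to the weight divides the scalar by p_k(- w). *)
Lemma DE_addalpha beta k :
  DE (beta + alpha k) * (algc ((-1) ^+ N k : K) * kap (proots (p k))) = DE beta.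
Proof.
rewrite -rev_kap.
rewrite /DE (bigD1 k) //= [RHS](bigD1 k) //= mulrAC; congr (_ * _); last first.
  by apply: eq_bigr => i ik; rewrite !mxE (negPf ik) andbF addr0.
rewrite !mxE !eqxx /= opprD.
rewrite -[in RHS](fps_exprz_pred (rev0 k)) /e mulrACA -rmorphM.
rewrite (_ : _ * lead_coef (q k) = lead_coef (q k) ^ (- beta 0 k)) //.
by rewrite -[X in _ * X]expr1z -expfzDr ?subrK ?lead0.
Qed.

Lemma DN_addalpha beta k : DN (beta + alpha k) + (N k)%:Z = DN beta.
Proof.
rewrite /DN (bigD1 k) //= [RHS](bigD1 k) //= addrAC; congr (_ + _); last first.
  by apply: eq_bigr => i ik; rewrite !mxE (negPf ik) andbF addr0.
by rewrite !mxE !eqxx /=; ring.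
Qed.

Lemma DE_opp beta : DE beta * DE (- beta) = 1.
Proof.
rewrite /DE -big_split big1 // => i _ /=.
rewrite mulrACA -rmorphM !mxE fps_exprzV // mulr1.
by rewrite -expfzDr ?lead0 // subrr expr0z rmorph1.
Qed.

Lemma DN_opp beta : DN (- beta) = - DN beta.
Proof.
by rewrite /DN -sumrN; apply: eq_bigr => i _; rewrite mxE mulrN.
Qed.

End Dscalar.

(** * Operators on root graded modules *)

Section Graded.
Variables (K : numClosedFieldType) (r : nat) (g : simple_datum r) (mu : 'rV[int]_r).
Local Notation Y := (Yangian K g mu).
Local Notation Q := 'rV[int]_r.
Variables (V : lmodType Y) (VQ : root_grading V).
Implicit Types (beta gamma : Q) (h : int -> V) (f : fps Y) (N B : int).

Lemma component_uniq v (c : Q -> V) : is_decomp VQ v c -> component VQ^~ v = c.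
Proof.
exact: (proj2 (svalP (cid (piece_decomp VQ v)))).
Qed.

Lemma component_decomp v : is_decomp VQ v (component VQ^~ v).
Proof. exact: (proj1 (svalP (cid (piece_decomp VQ v)))). Qed.

Lemma component_hom beta v gamma : VQ beta v ->
  component VQ gamma v = if gamma == beta then v else 0.
Proof.
move=> vb; have /(congr1 (fun c => c gamma)) // : component VQ^~ v = fun gamma => if gamma == beta then v else 0.
apply: component_uniq; split.
- by move=> b; have [bE|_] := eqVneq b beta; [rewrite bE|exact: piece0].
- apply: (@sub_finite_set _ _ [set beta]%classic) => [b /=|]; last exact: finite_set1.
  by have [//|_] := eqVneq b beta; rewrite eqxx.
- rewrite (fsbigE _ _ (_ : uniq [:: beta])) //; last first.
    by move=> b _; rewrite inE => /negPf ->.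
  by rewrite big_cons big_nil in_setT /= eqxx addr0.
Qed.

Lemma componentD beta u v : component VQ beta (u + v) = component VQ beta u + component VQ beta v.
Proof.
have /(congr1 (fun c => c beta)) // : component VQ^~ (u + v) = fun b => component VQ b u + component VQ b v.
have [u1 u2 u3] := component_decomp u; have [v1 v2 v3] := component_decomp v.
apply: component_uniq; split.
- by move=> b; exact: pieceD.
- apply: (@sub_finite_set _ _ ([set b | component VQ b u != 0] `|` [set b | component VQ b v != 0])%classic); last by rewrite finite_setU.
  move=> b /= uv0; case: (boolP (component VQ b u == 0)) => [/eqP u0|]; last by left.
  by right; rewrite u0 add0r in uv0.
have /finite_seqP[su uE] := u2; have /finite_seqP[sv vE] := v2.
have us : uniq (undup (su ++ sv)) by exact: undup_uniq.
have cu b : b \notin su -> component VQ b u = 0.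
  move=> bu; apply/eqP; apply: contraNT bu => cb.
  by have : [set` su]%classic b by rewrite -uE.
have cv b : b \notin sv -> component VQ b v = 0.
  move=> bv; apply/eqP; apply: contraNT bv => cb.
  by have : [set` sv]%classic b by rewrite -vE.
have snot b : b \notin undup (su ++ sv) -> b \notin su /\ b \notin sv.
  by rewrite mem_undup mem_cat negb_or => /andP.
have sumE (c : Q -> V) : (forall b, b \notin undup (su ++ sv) -> c b = 0) ->
    \sum_(b \in [set: Q]%classic) c b = \sum_(b <- undup (su ++ sv)) c b.
  move=> c0; rewrite (fsbigE _ _ us) //; last by move=> b _; exact: c0.
  by apply: eq_bigl => b; rewrite in_setT.
rewrite {1}u3 {1}v3 !sumE ?big_split // => b /snot[bu bv]; rewrite ?cu ?cv // addr0 //.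
Qed.

Lemma component0 beta : component VQ beta 0 = 0.
Proof. by rewrite (component_hom _ (piece0 VQ beta)); case: eqP. Qed.

Lemma Vw_bounded h : Vw_span VQ h -> exists B, bounded_by B h.
Proof.
elim=> [beta h' [[B hB] _]||h1 h2 _ [B1 b1] _ [B2 b2]]; first by exists B.
  by exists 0.
exists (Num.max B1 B2) => n; rewrite gt_max => /andP[n1 n2].
by rewrite -[LHS]/(h1 n + h2 n) b1 // b2 // addr0.
Qed.

Lemma lpiece_Lau gamma beta N f h : (forall m, Yhom gamma (f m)) ->
  lpiece VQ beta h -> lpiece VQ (gamma + beta) (lact (Lau N f) h).
Proof.
move=> fg [[B hB] hb]; split; first by exists (B + N); exact: Lau_bounded.
move=> n; have [M nM] : exists M : nat, B < n - N + M%:Z.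
  by exists (absz (B - (n - N))%R).+1; lia.
rewrite (lact_LauE f hB nM); apply: (big_ind (VQ (gamma + beta))).
- exact: piece0.
- by move=> u v; exact: pieceD.
- by move=> i _; apply: piece_act.
Qed.

Lemma Vw_Lau gamma N f h : (forall m, Yhom gamma (f m)) ->
  Vw_span VQ h -> Vw_span VQ (lact (Lau N f) h).
Proof.
move=> fg; elim=> [beta h' hb||h1 h2 s1 IH1 s2 IH2].
- exact: Vw_mem (lpiece_Lau N fg hb).
- by rewrite lact_zero; exact: Vw_zero.
- have [B1 b1] := Vw_bounded s1; have [B2 b2] := Vw_bounded s2.
  rewrite (@lact_LauD _ _ (Num.max B1 B2)); first exact: Vw_add.
  + by move=> n; rewrite gt_max => /andP[? _]; exact: b1.
  + by move=> n; rewrite gt_max => /andP[_ ?]; exact: b2.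
Qed.

Lemma Vw_LauD N f h1 h2 : Vw_span VQ h1 -> Vw_span VQ h2 ->
  lact (Lau N f) (h1 + h2) = lact (Lau N f) h1 + lact (Lau N f) h2.
Proof.
move=> /Vw_bounded[B1 b1] /Vw_bounded[B2 b2]; apply: (@lact_LauD _ _ (Num.max B1 B2)).
- by move=> n; rewrite gt_max => /andP[? _]; exact: b1.
- by move=> n; rewrite gt_max => /andP[_ ?]; exact: b2.
Qed.

Lemma Vw_Lau_comp N N' f f' h : Vw_span VQ h ->
  lact (Lau N f) (lact (Lau N' f') h) = lact (Lau (N + N') (f * f')) h.
Proof. by move=> /Vw_bounded[B hB]; exact: lact_Lau_comp hB. Qed.

(** The operator acting on V_(beta)((w^-1)) as w^N(beta) E(beta)(w^-1). *)
Section Diagonal.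
Variables (N : Q -> int) (E : Q -> fps K^o).

Definition diag h : int -> V :=
  \sum_(beta \in [set: Q]%classic)
    lact (Lau (N beta) (fscal Y (E beta))) (fun n => component VQ beta (h n)).

Lemma diag_hom beta h : lpiece VQ beta h ->
  diag h = lact (Lau (N beta) (fscal Y (E beta))) h.
Proof.
move=> [_ hb]; rewrite /diag (fsbigE _ _ (_ : uniq [:: beta])) //; last first.
  move=> b _; rewrite inE => /negPf bb.
  rewrite (_ : (fun n => _) = 0) ?lact_zero //.
  by apply/funext => n; rewrite (component_hom _ (hb n)) bb.
rewrite big_cons big_nil in_setT /= addr0; congr lact.
by apply/funext => n; rewrite (component_hom _ (hb n)) eqxx.
Qed.

(** A series of V^w has coefficients in finitely many pieces, which makes the sum
   in diag a finite one. *)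
Let Vw_support h : Vw_span VQ h ->
  exists s : seq Q, forall beta n, beta \notin s -> component VQ beta (h n) = 0.
Proof.
elim=> [beta h' [_ hb]||h1 h2 _ [s1 IH1] _ [s2 IH2]].
- by exists [:: beta] => b n; rewrite inE (component_hom _ (hb n)) => /negPf ->.
- by exists [::] => b n _; exact: component0.
- exists (s1 ++ s2) => b n; rewrite mem_cat negb_or => /andP[b1 b2].
  by rewrite componentD IH1 // IH2 // addr0.
Qed.

Let diagE s h : uniq s -> (forall beta n, beta \notin s -> component VQ beta (h n) = 0) ->
  diag h = \sum_(beta <- s)
    lact (Lau (N beta) (fscal Y (E beta))) (fun n => component VQ beta (h n)).
Proof.
move=> us hs; rewrite /diag (fsbigE _ _ us) //; last first.
  move=> b _ bs; rewrite (_ : (fun n => _) = 0) ?lact_zero //.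
  by apply/funext => n; exact: hs.
by apply: eq_bigl => b; rewrite in_setT.
Qed.

Lemma diagD h1 h2 : Vw_span VQ h1 -> Vw_span VQ h2 -> diag (h1 + h2) = diag h1 + diag h2.
Proof.
move=> v1 v2; have [s1 c1] := Vw_support v1; have [s2 c2] := Vw_support v2.
have [B1 b1] := Vw_bounded v1; have [B2 b2] := Vw_bounded v2.
pose s := undup (s1 ++ s2); have us : uniq s by exact: undup_uniq.
have sE b : (b \notin s) = (b \notin s1) && (b \notin s2).
  by rewrite mem_undup mem_cat negb_or.
rewrite !(diagE us) -?big_split; try by
  move=> b n; rewrite sE => /andP[bs1 bs2];
  rewrite ?componentD ?c1 ?c2 ?addr0.
apply: eq_bigr => b _ /=.
rewrite -(@lact_LauD _ _ (Num.max B1 B2)).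
- by congr lact; apply/funext => n; exact: componentD.
- by move=> n; rewrite gt_max => /andP[n1 _]; rewrite b1 ?component0.
- by move=> n; rewrite gt_max => /andP[_ n2]; rewrite b2 ?component0.
Qed.

Lemma diag0 : diag 0 = 0.
Proof.
rewrite (@diagE [::]) ?big_nil // => b n _; exact: component0.
Qed.

Let E_hom beta m : Yhom 0 (fscal Y (E beta) m).
Proof. by rewrite -[X in Yhom _ X]mulr1; apply: Yhom_scale; exact: Yhom_one. Qed.

Lemma diag_Vw h : Vw_span VQ h -> Vw_span VQ (diag h).
Proof.
elim=> [beta h' hb||h1 h2 s1 IH1 s2 IH2].
- rewrite (diag_hom hb); apply: Vw_Lau (Vw_mem hb); exact: E_hom.
- by rewrite diag0; exact: Vw_zero.
- by rewrite diagD //; exact: Vw_add.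
Qed.

End Diagonal.
End Graded.

(** * The intertwining operator *)

Section ZPolynomials.
Variables (K : numClosedFieldType) (A : pzAlgType K) (x : nat -> A).

(** The coefficient of w^m in the n-th coefficient of P(z, w) x(z). *)
Definition zcoef (P : {poly {poly K}}) n m : A :=
  \sum_(k < size P) algc (P`_k`_m) * x (n + k)%N.

(** p(z - w), for the monic polynomial p with roots l. *)
Let zprod (l : seq K) : {poly {poly K}} := \prod_(a <- l) ('X - ('X + a%:P)%:P).

Let zcoef_widen (P : {poly {poly K}}) n m B : (size P <= B)%N ->
  zcoef P n m = \sum_(k < B) algc (P`_k`_m) * x (n + k)%N.
Proof.
move=> PB; rewrite /zcoef (big_ord_widen _ (fun k => algc (P`_k`_m) * x (n + k)%N) PB).
rewrite [RHS](bigID (fun k : 'I_B => (k < size P)%N)) /= [X in _ = _ + X]big1 ?addr0 // => k.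
by rewrite -leqNgt => Pk; rewrite (nth_default _ Pk) coef0 rmorph0 mul0r.
Qed.

Let zcoef_cons a l n m : zcoef (zprod (a :: l)) n m =
  zcoef (zprod l) n.+1 m - (if m is j.+1 then zcoef (zprod l) n j else 0)
  - algc a * zcoef (zprod l) n m.
Proof.
have szP : (size (zprod (a :: l)) <= (size (zprod l)).+1)%N.
  rewrite /zprod big_cons (leq_trans (size_polyMleq _ _)) // size_XsubC.
  by [].
have coefE k : ((zprod (a :: l))`_k)`_m = (if k is i.+1 then (zprod l)`_i`_m else 0)
    - ((if m is j.+1 then (zprod l)`_k`_j else 0) + a * (zprod l)`_k`_m).
  rewrite /zprod big_cons -/(zprod l) mulrBl coefB coefXM coefCM coefB mulrDl coefD coefXM coefCM.
  by case: k => [|k]; rewrite ?coef0; case: m.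
rewrite (zcoef_widen _ _ szP).
under eq_bigr => k _ do rewrite coefE rmorphB mulrBl rmorphD mulrDl rmorphM -mulrA.
rewrite sumrB big_split /= opprD addrA; congr (_ - _ - _).
- rewrite big_ord_recl rmorph0 mul0r add0r; apply: eq_bigr => k _ /=.
  by rewrite addnS.
- case: m {coefE} => [|m]; first by rewrite big1 // => k _; rewrite rmorph0 mul0r.
  by rewrite (@zcoef_widen _ _ _ (size (zprod l)).+1).
- by rewrite -mulr_sumr (@zcoef_widen _ _ _ (size (zprod l)).+1).
Qed.

Let zcoef_high l n m : (size l < m)%N -> zcoef (zprod l) n m = 0.
Proof.
elim: l n m => [|a l IH] n [|m] //= lm.
  rewrite /zcoef /zprod big_nil size_poly1 big_ord1 coef1 /= coef1 rmorph0 mul0r //.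
by rewrite zcoef_cons !IH // 1?ltnW // mulr0 !subr0.
Qed.

(** The coefficient of z^-n-1 in p(z - w) x(z) is p(sigma - w) x_n. *)
Let zcoef_wrev l n : wrev (size l) (zcoef (zprod l) n) =
  algc ((-1) ^+ size l : K) * lins (-1) l (fun j => fconst (x j)) n.
Proof.
elim: l n => [|a l IH] n; apply: fpsP => m.
  rewrite fcoef_algcM rmorph1 mul1r /= /zcoef /zprod big_nil size_poly1 big_ord1 coef1 addn0 eqxx.
  by case: m => [|m] //=; rewrite coef1 rmorph1 mul1r.
have -> : algc ((-1) ^+ size (a :: l) : K) * lins (-1) (a :: l) (fun j => fconst (x j)) n =
    - lin (a, -1) (fun i => wrev (size l) (zcoef (zprod l) i)) n.
  have -> : (fun i => wrev (size l) (zcoef (zprod l) i)) = fun i => algc ((-1) ^+ size l : K) *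
      lins (-1) l (fun j => fconst (x j)) i by apply/funext => i; exact: IH.
  by rewrite linMl exprS mulN1r rmorphN mulNr.
rewrite fcoefN [LHS]/= zcoef_cons; case: m => [|m].
  by rewrite lin_coef0 !subn0 /= subn0 !(@zcoef_high l _ (size l).+1) // mulr0 subr0 sub0r.
rewrite lin_coefS /= subSS ltnS rmorphN1 mulN1r opprD opprD opprK.
case: ltngtP => [ml|ml|->].
- rewrite (_ : size l - m = (size l - m.+1).+1)%N; last by lia.
  by rewrite [RHS]addrA [RHS]addrC addrA.
- by rewrite mulr0 oppr0 !addr0.
- by rewrite subnn subr0 oppr0 add0r addrC.
Qed.

Lemma zcoef_zsubw (q : {poly K}) : q \is monic ->
  (forall n m, (size (proots q) < m)%N -> zcoef (zsubw q) n m = 0) /\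
  forall n, wrev (size (proots q)) (zcoef (zsubw q) n) =
    algc ((-1) ^+ size (proots q) : K) * lins (-1) (proots q) (fun j => fconst (x j)) n.
Proof.
move=> q1; suff -> : zsubw q = zprod (proots q).
  by split=> [n m|n]; [exact: zcoef_high|exact: zcoef_wrev].
rewrite /zsubw {1}(monic_proots q1) !rmorph_prod; apply: eq_bigr => a _ /=.
rewrite rmorphB /= map_polyX map_polyC /= comp_polyB comp_polyX comp_polyC.
by rewrite polyCD opprD addrA.
Qed.

End ZPolynomials.

Section Intertwining.
Variables (K : numClosedFieldType) (r : nat) (g : simple_datum r) (mu zeta : 'rV[int]_r).
Local Notation Y := (Yangian K g mu).
Local Notation Y' := (Yangian K g (mu + zeta)).
Local Notation Q := 'rV[int]_r.
Variables (p : 'I_r -> {poly K}) (A S : 'I_r -> fps Y).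
Hypotheses (hp : is_poly_lweight zeta p) (hA : is_GKLO A) (hS : is_Sseries A S).
Variables (F G : {rmorphism Y' -> wpoly Y}).
Hypotheses (hF : is_shiftF p F) (hG : is_shiftG p G).
Variables (V : lmodType Y) (VQ : root_grading V).
Implicit Types (beta gamma : Q) (h : int -> V).

Let p_monic i : p i \is monic. Proof. by case: (hp i). Qed.

Let Sp := Spoly p S.
Let D := diag VQ (DN p) (DE p).
Let T h : int -> V := D (lact (Lau 0 Sp) h).

Lemma Dop_diag h : Dop p VQ h = D h.
Proof.
rewrite /Dop /D /diag; apply: eq_fsbigr => beta _.
congr lact; apply/funext => k; rewrite (Dscalar_Lau p_monic) /Lau.
by case: (_ - k) => // m; rewrite rmorph0.
Qed.

Let Yhom0 (y : Y) : Yzero y -> Yhom 0 y.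
Proof.
elim=> [i q|k|y1 y2 _ h1 _ h2|y1 y2 _ h1 _ h2].
- exact: Yhom_xi.
- by rewrite -[algc k]mulr1; apply: Yhom_scale; exact: Yhom_one.
- exact: Yhom_add.
- by rewrite -[0]addr0; exact: Yhom_mul.
Qed.

Let Sp_hom m : Yhom 0 (Sp m).
Proof. by apply: Yhom0; exact: (Spoly_Yzero p hS). Qed.

Let T_Vw h : Vw_span VQ h -> Vw_span VQ (T h).
Proof. by move=> hV; apply: diag_Vw; exact: (Vw_Lau _ Sp_hom). Qed.

Let T_add h1 h2 : Vw_span VQ h1 -> Vw_span VQ h2 -> T (h1 + h2) = T h1 + T h2.
Proof.
by move=> v1 v2; rewrite /T (Vw_LauD _ _ v1 v2); apply: diagD; exact: (Vw_Lau _ Sp_hom).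
Qed.

Let T_zero : T 0 = 0.
Proof. by rewrite /T lact_zero /D diag0. Qed.

Let T_hom beta h : lpiece VQ beta h ->
  T h = lact (Lau (DN p beta) (fscal Y (DE p beta) * Sp)) h.
Proof.
move=> hb; have hV := Vw_mem hb.
rewrite /T /D (@diag_hom _ _ _ _ _ _ _ _ beta); last first.
  by rewrite -[beta]add0r; exact: (lpiece_Lau _ Sp_hom).
by rewrite (Vw_Lau_comp _ _ _ _ hV) addr0.
Qed.

(** Intertwining of w^MF uF(w^-1) and w^MG uG(w^-1), both of weight gamma, amounts to
    an identity of series in the algebra, since T is multiplication by
    w^(DN beta) E_beta S_p on the piece of weight beta. *)
Let intertwine gamma (MF MG : int) (uF uG : fps Y) h :
  (forall m, Yhom gamma (uF m)) ->
  (forall beta, DN p (gamma + beta) + MF = MG + DN p beta) ->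
  (forall beta, fscal Y (DE p (gamma + beta)) * (Sp * uF) = uG * (fscal Y (DE p beta) * Sp)) ->
  Vw_span VQ h -> T (lact (Lau MF uF) h) = lact (Lau MG uG) (T h).
Proof.
move=> uFh eN eE; elim=> [beta h' hb||h1 h2 v1 IH1 v2 IH2].
- rewrite (T_hom (lpiece_Lau MF uFh hb)) (T_hom hb).
  rewrite !(Vw_Lau_comp _ _ _ _ (Vw_mem hb)) eN -eE.
  by rewrite mulrA.
- by rewrite lact_zero T_zero lact_zero.
- have w1 := Vw_Lau MF uFh v1; have w2 := Vw_Lau MF uFh v2.
  rewrite (Vw_LauD _ _ v1 v2) (T_add w1 w2) (T_add v1 v2) IH1 IH2.
  by rewrite (Vw_LauD _ _ (T_Vw v1) (T_Vw v2)).
Qed.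

(** The generators are treated separately; the y with this property form a
   subalgebra. *)
Let intertwines (y : Y') := forall h, Vw_span VQ h ->
  T (lact (lau_of_wpoly (F y)) h) = lact (lau_of_wpoly (G y)) (T h).

Let intertwines_same (y : Y') : F y = G y -> (forall m, Yzero (F y m)) -> intertwines y.
Proof.
move=> FG Fy0 h hV; rewrite -FG; have [M FM] := wpoly_bound (F y).
rewrite (@lau_of_wpolyE _ M); last by move=> k Mk; apply: FM; exact: ltnW.
have u0 m : Yzero (wrev M (F y) m).
  rewrite /wrev /=; case: ifP => _ //; rewrite -(rmorph0 (@algc K Y)).
  exact: Yzero_scal.
apply: (@intertwine 0) => // [m|beta|beta]; first exact: Yhom0.
  by rewrite add0r addrC.
rewrite add0r fscalCA; congr (_ * _); apply: fpsP => m.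
rewrite fcoefM fcoefM_rev; apply: eq_bigr => j _; apply: Yzero_comm => //.
exact: (Spoly_Yzero p hS).
Qed.

Let alphaN (k : 'I_r) beta : DN p (alpha k + beta) + (size (proots (p k)))%:Z = DN p beta.
Proof. by rewrite addrC -[RHS](DN_addalpha p beta k) [alpha k + beta]addrC addrC. Qed.

Let alphaE (k : 'I_r) beta :
  fscal Y (DE p (alpha k + beta)) *
    (algc ((-1) ^+ size (proots (p k)) : K) * fscal Y (kap (proots (p k)))) =
  fscal Y (DE p beta).
Proof.
by rewrite -(DE_addalpha p_monic beta k) [beta + _]addrC !fscalM fscal_algc.
Qed.

Let wrev0 (y : Y) : wrev 0 (wconst y) = fconst y.
Proof. by apply: fpsP => -[|m]. Qed.

Let lau_wconst (y : Y) : lau_of_wpoly (wconst y) = Lau 0 (fconst y).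
Proof. by rewrite (@lau_of_wpolyE _ 0) ?wrev0 // => -[|k]. Qed.

Let wcoef_zmul (P : {poly {poly K}}) (f : int -> Y) n m :
  (zmul P (@wconst K r g mu \o f) n) m = \sum_(k < size P) algc (P`_k`_m) * f (n + k%:Z).
Proof.
rewrite /zmul.
have wcoef_sum (I : Type) (l : seq I) (H : I -> wpoly Y) :
    (\sum_(i <- l) H i) m = \sum_(i <- l) H i m.
  exact: (big_morph (fun P : wpoly Y => P m)).
rewrite wcoef_sum; apply: eq_bigr => k _.
exact: (Mfconst (f (n + k%:Z)) (wcoef (wpol g mu P`_k)) m).
Qed.

Let lau_zsubw s i n :
  lau_of_wpoly (zmul (zsubw (p i)) (@wconst K r g mu \o xser K g mu s i) n%:Z) =
  Lau (size (proots (p i)))%:Z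
    (wrev (size (proots (p i))) (zcoef (yx K g mu s i) (zsubw (p i)) n)).
Proof.
have cE m : (zmul (zsubw (p i)) (@wconst K r g mu \o xser K g mu s i) n%:Z) m =
    zcoef (yx K g mu s i) (zsubw (p i)) n m by rewrite wcoef_zmul.
have [high _] := zcoef_zsubw (yx K g mu s i) (p_monic i).
rewrite (@lau_of_wpolyE _ (size (proots (p i)))); last by move=> k sk; rewrite cE high.
by congr Lau; apply: fpsP => m; rewrite /wrev /= cE.
Qed.

Let algcCA (f h : fps Y) (k : K) : f * (algc k * h) = algc k * (f * h).
Proof. by rewrite mulrA -algcC -mulrA. Qed.

Let intertwines_algc (k : K) : intertwines (algc k).
Proof.
have [Fk _] := hF; have [Gk _] := hG.
apply: intertwines_same => [|[|m]]; rewrite Fk ?Gk //.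
  exact: Yzero_scal.
by rewrite -[X in Yzero X](rmorph0 (@algc K Y)); exact: Yzero_scal.
Qed.

Let intertwines_xi i q : intertwines (yxi K g (mu + zeta) i q).
Proof.
have [_ /(_ i)[_ _ Fxi]] := hF; have [_ /(_ i)[_ _ Gxi]] := hG.
have FE : F (yxi K g (mu + zeta) i q) =
  zmul (zsubw (p i)) (@wconst K r g mu \o xiser K g mu i) q := Fxi q.
apply: intertwines_same => [|m]; first by rewrite FE -[LHS]/(_ q) -Gxi.
rewrite FE wcoef_zmul; apply: (big_ind (@Yzero K r g mu)).
- by rewrite -(rmorph0 (@algc K Y)); exact: Yzero_scal.
- by move=> y z; exact: Yzero_add.
- by move=> k _; apply: Yzero_mul; [exact: Yzero_scal|exact: Yzero_xi].
Qed.

(** The factor p_i(- w) of S_p(w) p_i(sigma - w) x^+_i = p_i(- w) x^+_i S_p(w) is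
    compensated by the change of D from the weight beta to beta + alpha_i. *)
Let intertwines_xp i n : intertwines (yx K g (mu + zeta) true i n).
Proof.
move=> h hV.
have [_ /(_ i)[Fx _ _]] := hF; have [_ /(_ i)[Gx _ _]] := hG.
have -> : F (yx K g (mu + zeta) true i n) =
  zmul (zsubw (p i)) (@wconst K r g mu \o xser K g mu true i) n%:Z := Fx n%:Z.
have -> : G (yx K g (mu + zeta) true i n) = wconst (yx K g mu true i n) := Gx n%:Z.
rewrite lau_wconst.
rewrite (lau_zsubw true).
apply: (@intertwine (alpha i)) => // [m|beta|beta].
- rewrite /wrev /=; case: ifP => _; last exact: Yhom_zero.
  rewrite /zcoef; apply: (big_ind (Yhom (alpha i))).
  + exact: Yhom_zero.
  + by move=> y z; exact: Yhom_add.
  + by move=> k _; apply: Yhom_scale; exact: Yhom_xp.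
- by rewrite alphaN add0r.
- have [_ ->] := zcoef_zsubw (yx K g mu true i) (p_monic i).
  have Sx : Sp * lins (-1) (proots (p i)) (fun j => fconst (yx K g mu true i j)) n =
    fscal Y (kap (proots (p i))) * (fconst (yx K g mu true i n) * Sp).
    exact: (Spoly_conjugates p hA hS true i n).
  by rewrite algcCA Sx fscalCA -(alphaE i beta) -!mulrA.
Qed.

(** The change of D from beta to beta - alpha_i produces the factor p_i(- w) of
    S_p(w) p_i(- w) x^-_i = p_i(sigma - w) x^-_i S_p(w). *)
Let intertwines_xm i n : intertwines (yx K g (mu + zeta) false i n).
Proof.
move=> h hV.
have [_ /(_ i)[_ Fx _]] := hF; have [_ /(_ i)[_ Gx _]] := hG.
have -> : G (yx K g (mu + zeta) false i n) =
  zmul (zsubw (p i)) (@wconst K r g mu \o xser K g mu false i) n%:Z := Gx n%:Z.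
have -> : F (yx K g (mu + zeta) false i n) = wconst (yx K g mu false i n) := Fx n%:Z.
rewrite lau_wconst (lau_zsubw false).
apply: (@intertwine (- alpha i)) => // [m|beta|beta].
- by case: m => [|m]; [exact: Yhom_xm|exact: Yhom_zero].
- by rewrite -(alphaN i (- alpha i + beta)) addNKr addr0 addrC.
have [_ ->] := zcoef_zsubw (yx K g mu false i) (p_monic i).
have Sx : Sp * (fscal Y (kap (proots (p i))) * fconst (yx K g mu false i n)) =
    lins (-1) (proots (p i)) (fun j => fconst (yx K g mu false i j)) n * Sp.
  exact: (Spoly_conjugates p hA hS false i n).
rewrite -(alphaE i (- alpha i + beta)) addNKr [RHS]fscalCA -!mulrA -Sx.
by rewrite [Sp * (fscal _ _ * _)]fscalCA.
Qed.

Let VwP (h : Vw VQ) : Vw_span VQ (vseries h).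
Proof. by case: h => h /= /asboolP. Qed.

Let TV_subproof (h : Vw VQ) : T (vseries h) \in Vw_pred VQ.
Proof. by apply/asboolP; apply: T_Vw; exact: VwP. Qed.

Let TV (h : Vw VQ) : Vw VQ := MkVw (TV_subproof h).

Let TV_add (h1 h2 : Vw VQ) : TV (h1 + h2) = TV h1 + TV h2.
Proof.
by apply: val_inj; exact: (T_add (VwP h1) (VwP h2)).
Qed.

Let TV_act (y : Y') (h : Vw VQ) : TV (F y *: h) = G y *: TV h.
Proof.
elim/palg_ind: y h => [[[] i n|i q]|k|y1 y2 IH1 IH2|y1 y2 IH1 IH2] h.
- by apply: val_inj; exact: (intertwines_xp i n (VwP h)).
- by apply: val_inj; exact: (intertwines_xm i n (VwP h)).
- by apply: val_inj; exact: (intertwines_xi i q (VwP h)).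
- by apply: val_inj; exact: (intertwines_algc k (VwP h)).
- by rewrite !rmorphD !scalerDl TV_add IH1 IH2.
- by rewrite !rmorphM -!scalerA IH1 IH2.
Qed.

Let TV_linear : linear (TV : pullback F (Vw VQ) -> pullback G (Vw VQ)).
Proof. by move=> y h1 h2; rewrite -[LHS]/(TV (F y *: h1 + h2)) TV_add TV_act. Qed.

(** The inverse of T = D S_p(w) is S_p(w)^-1 D^-1, and D^-1 has the scalars of the
   opposite weights. *)
Let Sp_inv := fps_inv Sp.

Let homM (f h : fps Y) : (forall m, Yhom 0 (f m)) -> (forall m, Yhom 0 (h m)) ->
  forall m, Yhom 0 ((f * h) m).
Proof.
move=> f0 h0 m; rewrite fcoefM; apply: (big_ind (Yhom 0)).
- exact: Yhom_zero.
- by move=> y z; exact: Yhom_add.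
- by move=> j _; rewrite -[0]addr0; exact: Yhom_mul.
Qed.

Let hom_fscal (c : fps K^o) m : Yhom 0 (fscal Y c m).
Proof. by rewrite -[X in Yhom _ X]mulr1; apply: Yhom_scale; exact: Yhom_one. Qed.

Let Sp_inv_hom m : Yhom 0 (Sp_inv m).
Proof.
have hom1 j : Yhom 0 ((1 : fps Y) j) by rewrite -(fscal1 Y); exact: hom_fscal.
have homu j : Yhom 0 ((1 - Sp) j).
  rewrite fcoefB -mulN1r -(rmorphN1 (@algc K Y)).
  by apply: Yhom_add => //; exact: Yhom_scale.
have homX k : forall j, Yhom 0 (((1 - Sp) ^+ k) j).
  by elim: k => [//|k IH] j; rewrite exprS; exact: homM.
rewrite /Sp_inv /= fcoef_sum; apply: (big_ind (Yhom 0)).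
- exact: Yhom_zero.
- by move=> y z; exact: Yhom_add.
- by move=> k _; exact: homX.
Qed.

Let D' := diag VQ (fun beta => DN p (- beta)) (fun beta => DE p (- beta)).
Let T' h : int -> V := lact (Lau 0 Sp_inv) (D' h).

Let T'_add h1 h2 : Vw_span VQ h1 -> Vw_span VQ h2 -> T' (h1 + h2) = T' h1 + T' h2.
Proof.
by move=> v1 v2; rewrite /T' /D' (diagD _ _ v1 v2) (Vw_LauD _ _ (diag_Vw _ _ v1) (diag_Vw _ _ v2)).
Qed.

Let T'_Vw h : Vw_span VQ h -> Vw_span VQ (T' h).
Proof. by move=> hV; apply: (Vw_Lau _ Sp_inv_hom); exact: diag_Vw. Qed.

Let T'_zero : T' 0 = 0.
Proof. by rewrite /T' /D' diag0 lact_zero. Qed.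

Let T'_hom beta h : lpiece VQ beta h ->
  T' h = lact (Lau (- DN p beta) (Sp_inv * fscal Y (DE p (- beta)))) h.
Proof.
move=> hb; rewrite /T' /D' (diag_hom _ _ hb) (Vw_Lau_comp _ _ _ _ (Vw_mem hb)).
by rewrite add0r DN_opp.
Qed.

Let Sp0 : Sp 0%N = 1. Proof. exact: (Spoly0 p hS). Qed.

Let DE_inv beta : fscal Y (DE p (- beta)) * fscal Y (DE p beta) = 1.
Proof. by rewrite -fscalM mulrC DE_opp ?fscal1. Qed.

Let TK h : Vw_span VQ h -> T' (T h) = h.
Proof.
elim=> [beta h' hb||h1 h2 v1 IH1 v2 IH2].
- have Th := homM (hom_fscal (DE p beta)) Sp_hom.
  have := lpiece_Lau (DN p beta) Th hb; rewrite add0r (T_hom hb) => /T'_hom ->.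
  rewrite (Vw_Lau_comp _ _ _ _ (Vw_mem hb)) addNr -mulrA [_ * (_ * Sp)]mulrA DE_inv mul1r.
  by rewrite fps_Vmul //; have [B hB] := Vw_bounded (Vw_mem hb); exact: lact_Lau1 hB.
- by rewrite T_zero T'_zero.
- by rewrite (T_add v1 v2) (T'_add (T_Vw v1) (T_Vw v2)) IH1 IH2.
Qed.

Let T'K h : Vw_span VQ h -> T (T' h) = h.
Proof.
elim=> [beta h' hb||h1 h2 v1 IH1 v2 IH2].
- have Th := homM Sp_inv_hom (hom_fscal (DE p (- beta))).
  have := lpiece_Lau (- DN p beta) Th hb; rewrite add0r (T'_hom hb) => /T_hom ->.
  rewrite (Vw_Lau_comp _ _ _ _ (Vw_mem hb)) subrr -mulrA [Sp * (_ * _)]mulrA fps_mulV // mul1r.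
  rewrite -fscalM DE_opp // fscal1.
  by have [B hB] := Vw_bounded (Vw_mem hb); exact: lact_Lau1 hB.
- by rewrite T'_zero T_zero.
- by rewrite (T'_add v1 v2) (T_add (T'_Vw v1) (T'_Vw v2)) IH1 IH2.
Qed.

Let TV'_subproof (h : Vw VQ) : T' (vseries h) \in Vw_pred VQ.
Proof. by apply/asboolP; apply: T'_Vw; exact: VwP. Qed.

Theorem intertwiner : exists T : {linear pullback F (Vw VQ) -> pullback G (Vw VQ)},
    (forall h : Vw VQ,
       vseries (T h) = Dop p VQ (lact (lau_of_fps (Spoly p S)) (vseries h))) /\
    bijective T.
Proof.
pose L : {linear pullback F (Vw VQ) -> pullback G (Vw VQ)} := HB.pack
  (TV : pullback F (Vw VQ) -> pullback G (Vw VQ))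
  (GRing.isLinear.Build _ _ _ _ (TV : pullback F (Vw VQ) -> pullback G (Vw VQ)) TV_linear).
exists L; split=> [h|].
  by rewrite lau_of_fpsE Dop_diag.
exists (fun h : Vw VQ => MkVw (TV'_subproof h)) => h; apply: val_inj.
  exact: (TK (VwP h)).
exact: (T'K (VwP h)).
Qed.

End Intertwining.

Theorem theorem4p6 (R : realType) (r : nat) (g : simple_datum r)
    (mu zeta : 'rV[int]_r) (p : 'I_r -> {poly Cx R})
    (hp : is_poly_lweight zeta p)
    (A S : 'I_r -> fps (Yangian (Cx R) g mu))
    (hA : is_GKLO A) (hS : is_Sseries A S)
    (F G : {rmorphism Yangian (Cx R) g (mu + zeta) -> wpoly (Yangian (Cx R) g mu)})
    (hF : is_shiftF p F) (hG : is_shiftG p G)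
    (V : lmodType (Yangian (Cx R) g mu)) (VQ : root_grading V) :
  exists T : {linear pullback F (Vw VQ) -> pullback G (Vw VQ)},
    (forall h : Vw VQ,
       vseries (T h) = Dop p VQ (lact (lau_of_fps (Spoly p S)) (vseries h))) /\
    bijective T.
Proof. exact: (intertwiner hp hA hS hF hG VQ). Qed.
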